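(* Let $M_1=(N,\mathcal{I}_1),\dots,M_k=(N,\mathcal{I}_k)$ be matroids on a common ground set $N$, $|N|=n$, let $\mathcal{F}=\bigcap_{i=1}^k\mathcal{I}_i$, let $f\colon2^N\to\mathbb{R}_{\ge0}$ be nonnegative submodular, and let $\mathcal{A}$ be an $\alpha$-competitive secretary algorithm for maximizing a linear nonnegative weight function over $\mathcal{F}$. Consider the following algorithm with parameter $p$, run on elements arriving in uniformly random order: draw $X$ from $B(n,1/2)$, observe and reject the first $X$ arriving elements, forming the set $L$; let $G=\mathrm{Greedy}_f(L)$ and $E=\varnothing$; for each subsequently arriving $u\in N\setminus L$, set $w(u)=0$, and if $u\in\mathrm{Greedy}_f(L\cup\{u\})$ then with probability $p$ add $u$ to $E$ and set $w(u)=f(G_u\cup\{u\})-f(G_u)$, where $G_u$ is the solution held by $\mathrm{Greedy}_f$ run on $L\cup\{u\}$ immediately before it adds $u$; then pass $u$ to $\mathcal{A}$ with weight $w(u)$ (the elements of $L$ are also passed to $\mathcal{A}$ with weight $0$ so that $\mathcal{A}$ sees all of $N$ in uniformly random order). Output $Q\cap E$, where $Q$ is the output of $\mathcal{A}$. Then with $p=\frac{\alpha}{3k}$, $$\mathbb{E}[f(Q\cap E)]\ge\frac{\alpha^2}{128k^2}\,f(\mathrm{OPT}),$$ where $\mathrm{OPT}$ maximizes $f$ over $\mathcal{F}$.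
   Context: $\mathrm{Greedy}_f(T)$ for $T\subseteq N$ is the greedy algorithm for submodular maximization over $\mathcal{F}$ restricted to $T$: start with $S=\varnothing$; while some $e\in T\setminus S$ has $S\cup\{e\}\in\mathcal{F}$ and $f(S\cup\{e\})-f(S)>0$, add such an $e$ maximizing $f(S\cup\{e\})-f(S)$ (ties broken by a fixed consistent rule); return $S$. $\mathcal{A}$ being $\alpha$-competitive means: for elements arriving in uniformly random order with nonnegative weights revealed on arrival, $\mathcal{A}$ irrevocably selects a set in $\mathcal{F}$ whose expected weight is at least $\alpha$ times the maximum weight of a set in $\mathcal{F}$. $\alpha\in(0,1]$. *)

(* Defs.v *)
From mathcomp Require Import all_boot all_order all_algebra.
From mathcomp Require Import all_classical all_reals all_analysis.

Set Implicit Arguments.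
Unset Strict Implicit.
Unset Printing Implicit Defensive.

Import Order.TTheory GRing.Theory Num.Theory.
Local Open Scope set_scope.
Local Open Scope ring_scope.

Section SetSystems.
Variable N : finType.
Implicit Types (I : {set {set N}}) (S T : {set N}).

Definition matroid I : Prop :=
  [/\ finset.set0 \in I,
      forall S T, S \subset T -> T \in I -> S \in I
    & forall S T, S \in I -> T \in I -> (#|S| < #|T|)%N ->
        exists2 e, e \in T :\: S & e |: S \in I].

Definition common_independent k (I : 'I_k -> {set {set N}}) : {set {set N}} :=
  \bigcap_(i < k) I i.

Variable R : realType.
Implicit Type f : {set N} -> R.

Definition submodular f : Prop :=
  forall S T, f (S :|: T) + f (S :&: T) <= f S + f T.

Definition marginal f S (u : N) : R := f (u |: S) - f S.

Definition maximizes f (F : {set {set N}}) S : Prop :=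
  S \in F /\ forall T, T \in F -> f T <= f S.

End SetSystems.

Section Greedy.
Variables (R : realType) (N : finType) (F : {set {set N}}).
Variable f : {set N} -> R.
(* Among the tied elements, the least one for the total order [tie] is taken;
   the order is the same in all runs of the greedy algorithm. *)
Variable tie : rel N.
Implicit Types S T : {set N}.

Definition greedy_candidates T S : {set N} :=
  [set e in T :\: S | (e |: S \in F) && (0 < marginal f S e)].

Definition greedy_choice T S : option N :=
  [pick e in greedy_candidates T S |
    [forall e' in greedy_candidates T S,
      (marginal f S e' < marginal f S e) ||
      (marginal f S e' == marginal f S e) && tie e e']].

Definition greedy_step T S : {set N} :=
  if greedy_choice T S is Some e then e |: S else S.

(* Each productive step adds an element of T, so #|T| steps reach the point
   where no candidate is left. *)
Definition greedy T : {set N} := iter #|T| (greedy_step T) finset.set0.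

Fixpoint greedy_until T (u : N) (m : nat) S : {set N} :=
  if m is m'.+1 then
    if greedy_choice T S is Some e then
      if e == u then S else greedy_until T u m' (e |: S)
    else S
  else S.

(* The solution held by the run on T just before it adds u; meaningful only
   when u \in greedy T. *)
Definition greedy_before T (u : N) : {set N} := greedy_until T u #|T| finset.set0.

End Greedy.

Definition total_order (T : Type) (r : rel T) : Prop :=
  [/\ total r, transitive r & antisymmetric r].

Definition arrival_orders (N : finType) : {set #|N|.-tuple N} :=
  [set s : #|N|.-tuple N | uniq s].

Definition uniform_mean (R : realType) (T : finType) (B : {set T})
    (g : T -> R) : R :=
  #|B|%:R^-1 * \sum_(x in B) g x.

Section Secretary.
Variables (R : realType) (N : finType).

(* A deterministic online rule sees the (element, weight) pairs that have
   arrived so far and decides whether to select the last of them.  Its own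
   earlier decisions are functions of that history, so they are not passed. *)
Definition online_rule := seq (N * R) -> bool.

Fixpoint select_from (A : online_rule) (past todo : seq (N * R)) : {set N} :=
  if todo is x :: todo' then
    let h := rcons past x in
    (if A h then [set x.1] else finset.set0) :|: select_from A h todo'
  else finset.set0.

Definition selected (A : online_rule) (w : N -> R) (s : seq N) : {set N} :=
  select_from A [::] [seq (u, w u) | u <- s].

(* A randomized online algorithm is a random deterministic rule, the seed
   being a point of an arbitrary probability space, independent of the
   arrival order. *)
Record competitive d (Omega : measurableType d) (P : probability Omega R)
    (A : Omega -> online_rule) (F : {set {set N}}) (alpha : R) : Prop :=
  Competitive {
    competitive_measurable : forall h : seq (N * R),
      measurable_fun setT (fun o => A o h);
    competitive_feasible : forall (o : Omega) (w : N -> R),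
      (forall u, 0 <= w u) ->
      forall s, s \in arrival_orders N -> selected (A o) w s \in F;
    competitive_ratio : forall w : N -> R, (forall u, 0 <= w u) ->
      forall S, maximizes (fun T => \sum_(u in T) w u) F S ->
      alpha * \sum_(u in S) w u <=
        uniform_mean (arrival_orders N) (fun s =>
          \int[P]_o \sum_(u in selected (A o) w s) w u)
  }.

End Secretary.

Section OnlineAlgorithm.
Variables (R : realType) (N : finType) (F : {set {set N}}).
Variables (f : {set N} -> R) (tie : rel N).

(* [slots] says which positions of the input of the linear algorithm are
   taken by rejected elements (listed in [l]); the others are filled by the
   remaining elements, listed in [r]. *)
Fixpoint interleave (slots : bitseq) (l r : seq N) : seq N :=
  match slots, l, r with
  | true :: slots', v :: l', _ => v :: interleave slots' l' r
  | false :: slots', _, u :: r' => u :: interleave slots' l r'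
  | _, _, _ => [::]
  end.

Definition slot_patterns (x : nat) : {set #|N|.-tuple bool} :=
  [set b : #|N|.-tuple bool | count id b == x].

(* [C] is the set of elements whose p-biased coin shows heads. *)
Definition eligible (L C : {set N}) : {set N} :=
  [set u in ~: L | (u \in greedy F f tie (u |: L)) && (u \in C)].

Definition surrogate_weight (L C : {set N}) (u : N) : R :=
  if u \in eligible L C
  then marginal f (greedy_before F f tie (u |: L) u) u else 0.

(* Output for arrival order [s], sample size [x], coins [C] and positions
   [slots] of the sample in the input of the linear algorithm [A]. *)
Definition online_output (A : online_rule R N) (s : seq N) (x : nat)
    (C : {set N}) (slots : bitseq) : {set N} :=
  let L := [set u in take x s] in
  selected A (surrogate_weight L C) (interleave slots (take x s) (drop x s))
    :&: eligible L C.

Definition coin_prob (p : R) (C : {set N}) : R :=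
  \prod_(u : N) bernoulli_pmf p (u \in C).

(* The arrival order, the sample size, the coins, the slots of the sample and
   the seed of [A] are drawn independently, except that the slots are uniform
   among the patterns with as many slots as sampled elements.  Placing the
   sample at uniformly random slots makes the input order of [A] uniform even
   conditionally on the sample and the coins, hence on the weights. *)
Definition expected_output_value d (Omega : measurableType d)
    (P : probability Omega R) (A : Omega -> online_rule R N) (p : R) : R :=
  uniform_mean (arrival_orders N) (fun s =>
    \sum_(x < #|N|.+1) binomial_pmf #|N| (2%:R^-1) x *
      \sum_(C : {set N}) coin_prob p C *
        uniform_mean (slot_patterns x) (fun slots =>
          \int[P]_o f (online_output (A o) s x C slots))).

End OnlineAlgorithm.

(* Main.v *)
(* Process the elements as greedy does, but add the chosen element to the
   solution [M] only if it lies in the sample [L], and discard it otherwise.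
   Each chosen element then goes to [M] with probability 1/2, is eligible with
   probability p/2, and its marginal value w(u) at that time does not depend on
   its own coins.  With X = E[f(M)] - f(0), where f(0) is the value of the empty
   set, the following estimates combine to the claim.
   - f(OPT)/2 <= (k+2) X + f(0): M contains each element with probability at
     most 1/2, so E[f(M u OPT)] >= f(OPT)/2, and the marginals over M of the
     elements of OPT are charged to the discarded elements or, once per matroid,
     to M.
   - Dropping every eligible u spanned, in some matroid, by earlier eligible
     elements leaves a common independent set.  Before its coin is tossed, such
     a u is as likely to enter the independent set M; as the weights decrease
     along the run, the dropped weight is at most k p^2 X in expectation, out of
     p X.  So the linear algorithm collects at least alpha p (1 - k p) X.
   - Replacing w(u) by the marginal over M and the earlier coin-marked elements
     loses little, because adding a p-random set to M keeps at least a (1-p)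
     fraction of E[f(M)]. *)
Require Import Defs.
From mathcomp Require Import all_boot all_order all_algebra.
From mathcomp Require Import all_classical all_reals all_analysis.
From mathcomp Require Import ring lra.

Set Implicit Arguments.
Unset Strict Implicit.
Unset Printing Implicit Defensive.

Import Order.TTheory GRing.Theory Num.Theory.
Local Open Scope ring_scope.

(** * Marginal values of submodular functions and random subsets *)

Section SubmodularFunctions.
Variables (R : realType) (N : finType) (f : {set N} -> R).
Hypothesis f_submod : submodular f.
Implicit Types (S T A : {set N}) (u v : N) (t : seq N).

Lemma marginal_antitone S T u :
  S \subset T -> u \notin T -> marginal f T u <= marginal f S u.
Proof.
move=> sST uT; have := f_submod (u |: S) T.
have -> : (u |: S) :|: T = u |: T.
  apply/setP=> x; rewrite !inE; case: (boolP (x \in S)) => //= xS.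
    by rewrite (fintype.subsetP sST _ xS) !orbT.
  by rewrite orbF.
have -> : (u |: S) :&: T = S.
  apply/setP=> x; rewrite !inE; case: (boolP (x \in S)) => /= xS.
    by rewrite orbT (fintype.subsetP sST _ xS).
  by rewrite orbF; case: eqP => // ->; rewrite (negPf uT).
by rewrite /marginal; lra.
Qed.

Lemma union_gain_le_marginals S T :
  f (S :|: T) - f S <= \sum_(u in T) marginal f S u.
Proof.
rewrite -big_enum /=.
have {1}-> : T = [set x in enum T] by apply/setP=> x; rewrite inE mem_enum.
elim: (enum T) (enum_uniq T) => [_|u r IH /= /andP[ur /IH {}IH]].
  have -> : S :|: [set x in [::]] = S by apply/setP=> x; rewrite !inE orbF.
  by rewrite big_nil subrr.
rewrite big_cons.
have -> : S :|: [set x in u :: r] = u |: (S :|: [set x in r]).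
  by apply/setP=> x; rewrite !inE orbCA.
suff : marginal f (S :|: [set x in r]) u <= marginal f S u.
  by rewrite {1}/marginal; lra.
(* Diminishing returns needs [u] outside the larger set; an element of [S] has marginal 0 on both
   sides. *)
case: (boolP (u \in S)) => uS; last first.
  apply: marginal_antitone; last by rewrite !inE negb_or uS.
  by apply/fintype.subsetP=> x; rewrite !inE => ->.
rewrite /marginal.
have -> : u |: S = S by apply/setP=> x; rewrite !inE; case: eqP => // ->.
have -> : u |: (S :|: [set x in r]) = S :|: [set x in r].
  by apply/setP=> x; rewrite !inE; case: eqP => // ->; rewrite uS.
by rewrite !subrr.
Qed.

Definition before t u : seq N := take (index u t) t.

Lemma mem_before t u v : v \in before t u -> v \in t.
Proof. exact: mem_take. Qed.

Lemma before_notin t u : u \notin before t u.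
Proof.
rewrite /before; elim: t => //= x t IH.
by case: (eqVneq x u) => //= xu; rewrite inE negb_or eq_sym xu.
Qed.

Lemma before_rcons t u v : u \in t -> before (rcons t v) u = before t u.
Proof.
move=> ut; rewrite /before -cats1 index_cat ut take_cat index_mem ut.
by [].
Qed.

Lemma before_last t v : v \notin t -> before (rcons t v) v = t.
Proof.
move=> vt; rewrite /before -cats1 index_cat (negPf vt) /= eqxx addn0.
by rewrite take_size_cat.
Qed.

Lemma before_index t u v : v \in t ->
  (v \in before t u) = (index v t < index u t)%N.
Proof. exact: in_take. Qed.

Lemma before_trans t u v w :
  v \in before t u -> w \in before t v -> w \in before t u.
Proof.
move=> vu wv; have vt := mem_before vu; have wt := mem_before wv.
by move: vu wv; rewrite !before_index // => vu /ltn_trans; apply.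
Qed.

Lemma before_total t u v :
  u \in t -> v \in t -> [|| u == v, u \in before t v | v \in before t u].
Proof.
move=> ut vt; rewrite !before_index //; case: (ltngtP (index u t)) => //=.
  by rewrite orbT.
  by rewrite orbT.
by move=> uv; rewrite orbF -[v in _ == v](nth_index u vt) -uv nth_index.
Qed.

(** Telescoping along [t], skipping the elements outside [A]. *)
Lemma sum_prefix_marginals t A : uniq t ->
  \sum_(u <- t | u \in A) marginal f [set v in before t u | v \in A] u
    = f [set u in t | u \in A] - f finset.set0.
Proof.
elim/last_ind: t => [_|t x IH].
  rewrite big_nil.
  have -> : [set u in [::] | u \in A] = finset.set0 :> {set N}.
    by apply/setP=> v; rewrite !inE.
  by rewrite subrr.
rewrite rcons_uniq => /andP[xt /IH {}IH].
rewrite big_rcons /= big_seq_cond.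
under eq_bigr => u /andP[ut _] do rewrite before_rcons //.
rewrite -big_seq_cond before_last // IH.
case: ifP => xA.
  have -> : [set u in rcons t x | u \in A] = x |: [set u in t | u \in A].
    apply/setP=> u; rewrite !inE mem_rcons inE.
    by case: eqP => // ->; rewrite xA.
  by rewrite /marginal; lra.
rewrite addr0; congr (f _ - _); apply/setP=> u; rewrite !inE mem_rcons inE.
by case: eqP => // ->; rewrite xA andbF.
Qed.

(** Only the single inclusion probabilities of the random set [X] are bounded; no independence is
    assumed. Elements are added from the most to the least likely, each realized gain is at least
    the gain over the full set of the preceding elements, and Abel summation finishes. *)
Lemma sampling_lower_bound (T : finType) (q : T -> R) (X : T -> {set N})
    (p : R) :
  (forall S, 0 <= f S) -> (forall x, 0 <= q x) -> \sum_x q x = 1 -> 0 <= p ->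
  (forall u, \sum_(x | u \in X x) q x <= p) ->
  (1 - p) * f finset.set0 <= \sum_x q x * f (X x).
Proof.
move=> f_ge0 q_ge0 q1 p_ge0 qp; pose pr u := \sum_(x | u \in X x) q x.
have pr_ge0 u : 0 <= pr u by apply: sumr_ge0.
pose s := sort (fun u v => pr u <= pr v) (enum N).
(* The number [c] is a lower bound for all probabilities in [r]. Using the induction hypothesis with
   the probability of the head as [c] performs the Abel summation; [c = 0] gives the claim. *)
suff main c r : sorted (fun u v => pr u <= pr v) r -> uniq r ->
    0 <= c <= p -> (forall u, u \in r -> c <= pr u) ->
    (1 - p) * f finset.set0 + c * f [set u in r]
      <= \sum_x q x * f [set u in r | u \in X x].
  have s_sorted : sorted (fun u v => pr u <= pr v) s.
    by apply: sort_sorted => u v; exact: le_total.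
  have s_uniq : uniq s by rewrite sort_uniq enum_uniq.
  have := main 0 s s_sorted s_uniq.
  rewrite mul0r addr0 lexx p_ge0 => /(_ isT (fun u _ => pr_ge0 u)).
  congr (_ <= _); apply: eq_bigr => x _; congr (_ * f _); apply/setP=> u.
  by rewrite !inE mem_sort mem_enum.
elim: r c => [|u r IH] c r_sorted r_uniq /andP[c0 cp] c_le.
  have E0 (B : pred N) : [set v in [::] | B v] = finset.set0 :> {set N}.
    by apply/setP=> v; rewrite !inE.
  under eq_bigr do rewrite E0.
  rewrite -mulr_suml q1 mul1r.
  have -> : [set v in [::]] = finset.set0 :> {set N}.
    by apply/setP=> v; rewrite !inE.
  have := f_ge0 finset.set0; nra.
move: r_uniq => /= /andP[ur r_uniq].
have {}IH := IH (pr u) (path_sorted r_sorted) r_uniq.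
have /IH{}IH : 0 <= pr u <= p by rewrite pr_ge0 /= qp.
have pr_trans : transitive (fun v w => pr v <= pr w).
  by move=> a b d; exact: le_trans.
have /allP pr_le := order_path_min pr_trans r_sorted.
move/IH: pr_le => {}IH.
have step x : f [set v in r | v \in X x]
    + (if u \in X x then marginal f [set v in r] u else 0)
    <= f [set v in u :: r | v \in X x].
  have -> : [set v in u :: r | v \in X x] =
      if u \in X x then u |: [set v in r | v \in X x]
      else [set v in r | v \in X x].
    case: ifP => uX; apply/setP=> v; rewrite !inE.
      by case: eqP => // ->; rewrite uX.
    by case: eqP => // ->; rewrite uX !andbF.
  case: ifP => uX; last by rewrite addr0.
  rewrite -lerBrDl; apply: marginal_antitone; rewrite ?inE //.
  by apply/fintype.subsetP=> v; rewrite !inE => /andP[].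
apply: (@le_trans _ _ (\sum_x q x * (f [set v in r | v \in X x]
    + (if u \in X x then marginal f [set v in r] u else 0)))); last first.
  by apply: ler_sum => x _; apply: ler_wpM2l.
under eq_bigr do rewrite mulrDr.
rewrite big_split /=.
under [X in _ <= _ + X]eq_bigr do rewrite (fun_if (fun z => _ * z)) mulr0.
rewrite -big_mkcond /= -mulr_suml -/(pr u).
have -> : [set v in u :: r] = u |: [set v in r].
  by apply/setP=> v; rewrite !inE.
(* Nonnegativity of [f] allows lowering the coefficient from [pr u] to [c]. *)
have := c_le u (mem_head _ _); have := f_ge0 (u |: [set v in r]).
move: IH; rewrite /marginal; nra.
Qed.

End SubmodularFunctions.

(** * Comparing weighted sums by counting above thresholds *)

Section ThresholdCounting.
Variables (R : realType) (N : finType).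
Implicit Types (X Y : {set N}) (v w : N -> R).

(** The heaviest elements [x] of [X] and [y] of [Y] are paired and removed. Thresholds up to [v x]
    lose one element on each side; above [v x] nothing of [X] is left to count. *)
Lemma sum_le_of_threshold_counts X Y v w :
  (forall x, x \in X -> 0 < v x) -> (forall y, y \in Y -> 0 <= w y) ->
  (forall c : R, 0 < c ->
     (#|[set x in X | (c <= v x)%R]| <= #|[set y in Y | (c <= w y)%R]|)%N) ->
  \sum_(x in X) v x <= \sum_(y in Y) w y.
Proof.
move: {2}#|X| (leqnn #|X|) => n; elim: n X Y => [|n IH] X Y.
  rewrite leqn0 cards_eq0 => /eqP-> _ w_ge0 _.
  by rewrite big_set0; apply: sumr_ge0.
have [->|[x0 x0X]] := set_0Vmem X.
  by move=> _ _ w_ge0 _; rewrite big_set0; apply: sumr_ge0.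
move=> Xn v_gt0 w_ge0 count.
have [x xX x_max] : exists2 x, x \in X & forall z, z \in X -> v z <= v x.
  by case: (Order.TotalTheory.arg_maxP v x0X) => x xX x_max; exists x.
have : (0 < #|[set y in Y | (v x <= w y)%R]|)%N.
  apply: leq_trans (count _ (v_gt0 x xX)).
  by rewrite card_gt0; apply/set0Pn; exists x; rewrite inE xX /=.
rewrite card_gt0 => /set0Pn[y0]; rewrite inE => /andP[y0Y vx_le].
have [y yY y_max] : exists2 y, y \in Y & forall z, z \in Y -> w z <= w y.
  by case: (Order.TotalTheory.arg_maxP w y0Y) => y yY y_max; exists y.
have vw : v x <= w y := le_trans vx_le (y_max _ y0Y).
rewrite (big_setD1 x xX) (big_setD1 y yY) /=; apply: lerD => //; apply: IH.
- by rewrite -ltnS (leq_trans _ Xn) // [X in (_ < X)%N](cardsD1 x) xX.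
- by move=> z; rewrite !inE => /andP[_ /v_gt0].
- by move=> z; rewrite !inE => /andP[_ /w_ge0].
move=> c c_gt0; case: (leP c (v x)) => cx; last first.
  have -> : [set z in X :\ x | c <= v z] = finset.set0.
    apply/setP=> z; rewrite !inE; apply/negP=> /andP[/andP[_ /x_max zx] cz].
    by move: (lt_le_trans cx (le_trans cz zx)); rewrite ltxx.
  by rewrite cards0.
have := count c c_gt0.
rewrite (cardsD1 x) [X in (_ <= X)%N](cardsD1 y) !inE xX yY cx (le_trans cx vw).
rewrite /= !add1n ltnS.
have setD1_sep (Z : {set N}) (u : N) (P : pred N) :
    [set z in Z :\ u | P z] = [set z in Z | P z] :\ u.
  by apply/setP=> z; rewrite !inE andbA.
by rewrite !setD1_sep.
Qed.

End ThresholdCounting.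

(** * Span and independence in a single matroid *)

Section MatroidBlocking.
Variables (N : finType) (I : {set {set N}}).
Hypothesis I_matroid : matroid I.
Implicit Types (X Y Z B : {set N}).

(* For [x] outside [Y] this says that [x] lies in the matroid span of [Y]. *)
Definition blocked Y (x : N) : bool :=
  [exists B : {set N}, [&& B \subset Y, B \in I & x |: B \notin I]].

Lemma blockedS Y Z x : Y \subset Z -> blocked Y x -> blocked Z x.
Proof.
move=> YZ /existsP[B /and3P[BY BI xB]]; apply/existsP; exists B.
by rewrite (fintype.subset_trans BY YZ) BI.
Qed.

(** A rank comparison: a largest independent [B] inside [Y], if smaller than [X], could be enlarged
    by some [x] of [X], although [x] is spanned by [Y]. *)
Lemma card_independent_blocked X Y :
  X \in I -> (forall x, x \in X -> blocked Y x) -> (#|X| <= #|Y|)%N.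
Proof.
case: I_matroid => I0 Isub Iaug XI Xblocked.
pose P B := (B \in I) && (B \subset Y).
have P0 : P finset.set0 by rewrite /P I0 finset.sub0set.
case: (arg_maxnP (fun B : {set N} => #|B|) P0) => B /andP[BI BY] B_max.
rewrite leqNgt; apply/negP=> YX.
have BX : (#|B| < #|X|)%N by apply: leq_ltn_trans YX; exact: subset_leq_card.
have [x] := Iaug _ _ BI XI BX; rewrite inE => /andP[xB xX] xBI.
have /existsP[C /and3P[CY CI xC]] := Xblocked x xX.
(* The blocking set [C] is extended to a largest independent [D] inside [Y]. Augmenting [D] from
   [x |: B] contradicts either the blocking by [C] or the maximality of [D]. *)
pose P' B := P B && (C \subset B).
have PC : P' C by rewrite /P' /P CI CY fintype.subxx.
case: (arg_maxnP (fun B : {set N} => #|B|) PC) => D /andP[/andP[DI DY] CD]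
  D_max.
have DB : (#|D| < #|x |: B|)%N.
  by rewrite cardsU1 xB add1n ltnS; apply: B_max; rewrite /P DI.
have [y] := Iaug _ _ DI xBI DB; rewrite !inE => /andP[yD /orP[/eqP yx|yB]] yDI.
  move/negP: xC; apply; apply: Isub yDI; rewrite yx.
  by apply/fintype.subsetP=> z;
    rewrite !inE => /orP[->//|/(fintype.subsetP CD)->]; rewrite orbT.
suff /D_max : P' (y |: D) by rewrite /geq /= cardsU1 yD add1n ltnn.
rewrite /P' /P yDI finset.subUset finset.sub1set (fintype.subsetP BY _ yB) DY
  /=.
by apply: fintype.subset_trans CD _; exact: finset.subsetUr.
Qed.

(** The part of [X] in a prefix is an independent subset of the earlier elements of [Y]; if adding
    the next element destroyed independence, it would witness that this element is blocked. *)
Lemma unblocked_independent (t : seq N) (X Y : {set N}) :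
  uniq t -> X \subset Y ->
  (forall u, u \in t -> u \in X -> ~~ blocked [set v in before t u | v \in Y]
    u) ->
  [set u in t | u \in X] \in I.
Proof.
have [I0 _ _] := I_matroid; move=> + XY.
elim/last_ind: t => [_ _|t x IH].
  by rewrite (_ : [set _ in _ | _] = finset.set0) //; apply/setP=> v;
    rewrite !inE.
rewrite rcons_uniq => /andP[xt t_uniq] free.
have tI : [set u in t | u \in X] \in I.
  apply: IH => // u ut; rewrite -(before_rcons x ut); apply: free.
  by rewrite mem_rcons inE ut orbT.
have -> : [set u in rcons t x | u \in X] =
    if x \in X then x |: [set u in t | u \in X] else [set u in t | u \in X].
  case: ifP => xX; apply/setP=> v; rewrite ?inE mem_rcons ?inE.
    by case: eqP => // ->; rewrite xX.
  by case: eqP => // ->; rewrite xX !andbF.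
case: ifP => // xX; have := free x _ xX.
rewrite mem_rcons mem_head before_last // => /(_ isT).
rewrite negb_exists => /forallP/(_ [set u in t | u \in X]).
rewrite tI /= negb_and negbK => /orP[/negP[]|//].
by apply/fintype.subsetP=> v; rewrite !inE => /andP[-> /(fintype.subsetP XY)].
Qed.

End MatroidBlocking.

(** * Sets of independent biased coins *)

Section IndependentCoins.
Variables (R : realType) (N : finType).
Implicit Types (C S : {set N}) (p : R) (g : {set N} -> R).

Lemma coin_prob_ge0 p C : 0 <= p <= 1 -> 0 <= coin_prob p C.
Proof. by move=> p01; apply: prodr_ge0 => u _; apply: bernoulli_pmf_ge0. Qed.

Lemma sum_coin_prob p : \sum_(C : {set N}) coin_prob p C = 1.
Proof.
have <- : \prod_(u : N) (p + (1 - p)) = 1.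
  by rewrite big1 // => u _; rewrite addrC subrK.
rewrite bigA_distr /=; apply: eq_bigl => C; by rewrite inE.
Qed.

(** The hypothesis says that [g] ignores the coin of [u]. This coin factors out of [coin_prob], and
    adding [u] to [C] pairs tails with heads. *)
Lemma coin_independence p g u : (forall C, g (u |: C) = g C) ->
  \sum_(C : {set N} | u \in C) coin_prob p C * g C
    = p * \sum_(C : {set N}) coin_prob p C * g C.
Proof.
move=> gu; pose K C := \prod_(v | v != u) bernoulli_pmf p (v \in C).
have coinE C : coin_prob p C = (if u \in C then p else 1 - p) * K C.
  by rewrite /coin_prob (bigD1 u).
have Ku C : K (u |: C) = K C.
  by apply: eq_bigr => v vu; rewrite !inE (negPf vu).
rewrite [in RHS](bigID (fun C : {set N} => u \in C)) /=.
have inE' : \sum_(C : {set N} | u \in C) coin_prob p C * g C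
    = p * \sum_(C : {set N} | u \notin C) K C * g C.
  rewrite mulr_sumr (reindex_onto (fun C => u |: C) (fun C => C :\ u)) /=.
    apply: eq_big => [C|C /andP[uC _]].
      rewrite !inE eqxx /=; apply/eqP/idP => [<-|uC];
        first by rewrite !inE eqxx.
      by apply/setP=> v; rewrite !inE; case: eqP => // ->; rewrite (negPf uC).
    by rewrite coinE uC Ku gu mulrA.
  by move=> C uC; rewrite finset.setD1K.
have outE : \sum_(C : {set N} | u \notin C) coin_prob p C * g C
    = (1 - p) * \sum_(C : {set N} | u \notin C) K C * g C.
  rewrite mulr_sumr; apply: eq_bigr => C uC.
  by rewrite coinE (negPf uC) mulrA.
by rewrite outE inE'; ring.
Qed.

Lemma sum_coin_prob_subset_le p (X : {set N} -> {set N}) u : 0 <= p <= 1 ->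
  (forall C, X C \subset C) ->
  \sum_(C : {set N} | u \in X C) coin_prob p C <= p.
Proof.
move=> p01 XC.
have := @coin_independence p (fun=> 1) u (fun=> erefl).
under eq_bigr do rewrite mulr1; under [X in _ = _ * X]eq_bigr do rewrite mulr1.
rewrite sum_coin_prob mulr1 => {2}<-.
rewrite [leLHS]big_mkcond [leRHS]big_mkcond /=; apply: ler_sum => C _.
case: ifP => [/(fintype.subsetP (XC C))->//|_].
by case: ifP => // _; exact: coin_prob_ge0.
Qed.

End IndependentCoins.

(** * The greedy run that discards elements outside the sample *)

Section ConsiderationOrder.
Variables (R : realType) (N : finType) (F : {set {set N}}).
Variables (f : {set N} -> R) (tie : rel N).
Hypothesis tie_order : total_order tie.
Implicit Types (L M S T : {set N}) (u v e : N) (t : seq N).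

Let cand := greedy_candidates F f.
Let choice := greedy_choice F f tie.

Lemma greedy_choice_some T S e : choice T S = Some e ->
  e \in cand T S /\ forall e', e' \in cand T S ->
    (marginal f S e' < marginal f S e)
    || (marginal f S e' == marginal f S e) && tie e e'.
Proof.
rewrite /choice /greedy_choice; case: pickP => // x /andP[xC /forall_inP xmax].
by case=> <-.
Qed.

Lemma greedy_choice_unique T S e : e \in cand T S ->
  (forall e', e' \in cand T S ->
    (marginal f S e' < marginal f S e)
    || (marginal f S e' == marginal f S e) && tie e e') ->
  choice T S = Some e.
Proof.
move=> eC e_max; rewrite /choice /greedy_choice.
case: pickP => [x /andP[xC /forall_inP x_max]|/(_ e)]; last first.
  by rewrite [e \in _]eC /= => /negP[]; apply/forall_inP.
have := x_max e eC; have := e_max x xC.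
case: ltgtP => //= _ ex xe; congr Some.
by case: tie_order => _ _; apply; rewrite xe.
Qed.

(** A nonempty candidate set yields a choice: the candidates of largest marginal are sorted by
    [tie], and the first one qualifies. *)
Lemma greedy_choice_none T S : choice T S = None -> cand T S = finset.set0.
Proof.
move=> noc; apply/eqP/set0Pn => -[e0 e0C].
have [e1 e1C e1_max] : exists2 e, e \in cand T S &
    forall e', e' \in cand T S -> marginal f S e' <= marginal f S e.
  by case: (Order.TotalTheory.arg_maxP (marginal f S) e0C) => e eC H; exists e.
have [tie_total tie_trans tie_anti] := tie_order.
pose D := [set e in cand T S | marginal f S e == marginal f S e1].
pose s := sort tie (enum D).
have e1D : e1 \in D by rewrite inE e1C eqxx.
have s_sorted : sorted tie s by apply: sort_sorted.
have mem_s v : (v \in s) = (v \in D) by rewrite mem_sort mem_enum.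
case s_eq : s => [|e r].
  by have := mem_s e1; rewrite s_eq e1D.
have eD : e \in D by rewrite -mem_s s_eq mem_head.
move: (eD); rewrite inE => /andP[eC /eqP e_val].
have /allP e_min : all (tie e) r.
  by apply: order_path_min => //; rewrite s_eq in s_sorted.
have tie_refl : tie e e by have := tie_total e e; rewrite orbb.
rewrite (@greedy_choice_unique T S e) // in noc => e' e'C.
rewrite e_val lt_neqAle e1_max // andbT.
case: eqP => //= e'_val; have : e' \in s by rewrite mem_s inE e'C e'_val /=.
by rewrite s_eq inE => /orP[/eqP->|/e_min].
Qed.

Lemma candS T T' S : T' :\: S \subset T -> {subset cand T' S <= cand T S}.
Proof.
move=> /fintype.subsetP TT' e; rewrite !inE => /andP[/andP[eS eT'] ->].
by rewrite eS TT' // inE eS.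
Qed.

(** Consistent tie-breaking makes the best candidate unique, so it remains the choice when others
    are withdrawn. This couples runs on different ground sets. *)
Lemma greedy_choice_shrink T T' S e : T' :\: S \subset T -> e \in T' ->
  choice T S = Some e -> choice T' S = Some e.
Proof.
move=> TT' eT' /greedy_choice_some[eC e_max]; apply: greedy_choice_unique.
  by move: eC; rewrite !inE => /andP[/andP[-> _] ->]; rewrite eT'.
by move=> e' /(candS TT')/e_max.
Qed.

Lemma greedy_choice_none_shrink T T' S : T' :\: S \subset T ->
  choice T S = None -> choice T' S = None.
Proof.
move=> TT' /greedy_choice_none T0; case E : (choice T' S) => [e|] //.
by have [/(candS TT')] := greedy_choice_some E; rewrite T0 inE.
Qed.

(* Greedy run on all of [T], where a chosen element outside [L] is discarded
   instead of being added to the current solution [M]. Whether [u \in L] is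
   examined only when [u] is chosen, so if [L] is a random sample the coin of
   [u] is still fresh at that time. *)
Fixpoint consider L n T M : seq N :=
  if n is n'.+1 then
    if choice T M is Some e then
      e :: consider L n' (T :\ e) (if e \in L then e |: M else M)
    else [::]
  else [::].

Definition kept L M (t : seq N) : {set N} := M :|: [set v in t | v \in L].

Lemma kept_nil L M : kept L M [::] = M.
Proof. by apply/setP=> v; rewrite !inE orbF. Qed.

Lemma kept_cons L M e t :
  kept L M (e :: t) = kept L (if e \in L then e |: M else M) t.
Proof.
apply/setP=> v; rewrite !inE; case: ifP => eL; rewrite ?inE.
  by case: eqP => [->|_]; rewrite ?eL ?orbT.
by case: eqP => [->|_] //=; rewrite eL andbF.
Qed.

Lemma before_cons e t u :
  before (e :: t) u = if e == u then [::] else e :: before t u.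
Proof. by rewrite /before /=; case: ifP. Qed.

Lemma mem_consider L n T M u : u \in consider L n T M -> u \in T.
Proof.
elim: n T M => //= n IH T M; case E : (choice T M) => [e|] //.
have [] := greedy_choice_some E; rewrite inE => /andP[+ _] _.
rewrite inE => /andP[_ eT]; rewrite inE => /orP[/eqP->//|/IH].
by rewrite !inE => /andP[].
Qed.

Lemma consider_uniq L n T M : uniq (consider L n T M).
Proof.
elim: n T M => //= n IH T M; case: (choice T M) => [e|] //=.
by rewrite IH andbT; apply/negP=> /mem_consider; rewrite !inE eqxx.
Qed.

Lemma consider_candidate L n T M u (t := consider L n T M) : u \in t ->
  u \in cand T (kept L M (before t u)).
Proof.
rewrite {}/t; elim: n T M => //= n IH T M; case E : (choice T M) => [e|] //.
have [eC _] := greedy_choice_some E; rewrite before_cons inE eq_sym.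
case: eqP => [<- _|_ /= /IH]; first by rewrite kept_nil.
by rewrite kept_cons; apply: candS; apply/fintype.subsetP=> v;
  rewrite !inE => /and3P[].
Qed.

Lemma consider_max L n T M u v (t := consider L n T M)
    (Mu := kept L M (before t u)) :
  u \in t -> v \in T -> v \notin before t u -> v |: Mu \in F ->
  marginal f Mu v <= marginal f Mu u.
Proof.
rewrite {}/Mu {}/t; elim: n T M => //= n IH T M.
case E : (choice T M) => [e|] //.
have [eC e_max] := greedy_choice_some E; rewrite before_cons inE eq_sym.
case: eqP => [<- _ vT _|_ /= ut vT].
  rewrite kept_nil => vF; case: (boolP (v \in cand T M)) => vC.
    by case/orP: (e_max v vC) => [/ltW//|/andP[/eqP->]].
  (* If [v] is no candidate, it lies in [M] or has a nonpositive marginal, whereas the chosen [e]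
     has a positive one. *)
  move: (eC); rewrite !inE => /and3P[_ _ eM].
  apply: le_trans (ltW eM); move: vC; rewrite !inE vT vF /= andbT negb_and.
  case/orP=> [|]; last by rewrite -leNgt.
  rewrite negbK => vM; rewrite /marginal.
  by rewrite (_ : v |: M = M) ?subrr //; apply/finset.setUidPr;
    rewrite finset.sub1set.
rewrite kept_cons inE negb_or => /andP[ve vb]; apply: IH => //.
by rewrite !inE ve.
Qed.

(** The bound on [#|T|] ensures that the run stops for want of candidates, not of steps. *)
Lemma consider_end L n T M v (t := consider L n T M) (Me := kept L M t) :
  (#|T| <= n)%N -> v \in T -> v \notin t -> v |: Me \in F ->
  marginal f Me v <= 0.
Proof.
rewrite {}/Me {}/t; elim: n T M => /= [|n IH] T M.
  by rewrite leqn0 cards_eq0 => /eqP->; rewrite inE.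
case E : (choice T M) => [e|] Tn vT.
  have [] := greedy_choice_some E; rewrite inE => /andP[+ _] _.
  rewrite inE => /andP[_ eT].
  rewrite kept_cons inE negb_or => /andP[ve vb]; apply: IH => //.
    by move: Tn; rewrite (cardsD1 e) eT.
  by rewrite !inE ve.
move=> _; rewrite kept_nil => vF; rewrite leNgt; apply/negP=> v_pos.
have := greedy_choice_none E => /setP/(_ v); rewrite !inE vT vF v_pos !andbT.
move/negbFE => vM; move: v_pos; rewrite /marginal.
by rewrite (_ : v |: M = M) ?subrr ?ltxx //; apply/finset.setUidPr;
  rewrite finset.sub1set.
Qed.

Lemma kept_consider_feasible L n T M : M \in F -> kept L M (consider L n T M)
  \in F.
Proof.
elim: n T M => [|n IH] T M MF /=; first by rewrite kept_nil.
case E : (choice T M) => [e|]; last by rewrite kept_nil.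
have [eC _] := greedy_choice_some E; rewrite kept_cons; apply: IH.
by case: ifP => // _; move: eC; rewrite !inE => /and3P[_ ->].
Qed.

(** After [u] is chosen the two runs may diverge, so only the prefix and the fact that [u] is
    reached are compared. *)
Lemma consider_local L L' n T M u : (forall v, v != u -> (v \in L) = (v \in
  L')) ->
  before (consider L n T M) u = before (consider L' n T M) u
  /\ (u \in consider L n T M) = (u \in consider L' n T M).
Proof.
move=> LL'; elim: n T M => //= n IH T M; case: (choice T M) => [e|] //.
rewrite !before_cons !inE; case: eqVneq => [//|eu] /=.
by rewrite -LL' //; case: (IH (T :\ e) (if e \in L then e |: M else M)) => ->
  ->.
Qed.

(** A chosen element of [L] is also the choice among [L] alone, and discarding an element is no step
    of greedy on [L]. Hence both processes hold the same solution, with separate step counts [n] and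
    [m]. *)
Lemma iter_greedy_step L n m T M :
  (#|T| <= n)%N -> (#|L :\: M| <= m)%N -> L :\: M \subset T ->
  iter m (greedy_step F f tie L) M = kept L M (consider L n T M).
Proof.
have stuck S k : choice L S = None -> iter k (greedy_step F f tie L) S = S.
  move=> noc; elim: k => //= k ->.
  by rewrite /greedy_step; move: noc; rewrite /choice => ->.
elim: n m T M => [|n IH] m T M /=.
  rewrite leqn0 cards_eq0 => /eqP-> _ LT; rewrite kept_nil stuck //.
  apply: (@greedy_choice_none_shrink finset.set0) => //.
  case E : choice => [e|] //; have [] := greedy_choice_some E.
  by rewrite !inE andbF.
case E : (choice T M) => [e|] Tn Lm LT; last first.
  by rewrite kept_nil stuck //; exact: greedy_choice_none_shrink E.
have [] := greedy_choice_some E; rewrite inE => /andP[+ _] _.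
rewrite inE => /andP[eM eT]; rewrite kept_cons.
have Tn' : (#|T :\ e| <= n)%N by move: Tn; rewrite (cardsD1 e) eT.
case: ifP => eL; last first.
  apply: IH => //; apply/fintype.subsetP=> v vLM;
    rewrite !inE (fintype.subsetP LT _ vLM) andbT.
  by apply: contraTneq vLM => ->; rewrite !inE eL andbF.
have eLM : e \in L :\: M by rewrite inE eM eL.
have LM : L :\: (e |: M) = (L :\: M) :\ e.
  by apply/setP=> v; rewrite !inE negb_or andbA.
case: m Lm => [|m] Lm; first by move: Lm; rewrite (cardsD1 e) eLM.
rewrite iterSr.
have -> : greedy_step F f tie L M = e |: M.
  by rewrite /greedy_step; have := greedy_choice_shrink LT eL E;
    rewrite /choice => ->.
apply: IH => //; rewrite LM.
  by move: Lm; rewrite (cardsD1 e) eLM.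
by apply/fintype.subsetP=> v; rewrite !inE => /and3P[-> vM vL];
  apply: (fintype.subsetP LT); rewrite inE vM.
Qed.

Lemma greedy_until_consider L n m T M u (t := consider L n T M) :
  (#|T| <= n)%N -> (#|L :\: M| <= m)%N -> L :\: M \subset T ->
  u \in L -> u \in t ->
  greedy_until F f tie L u m M = kept L M (before t u).
Proof.
rewrite {}/t; elim: n m T M => [|n IH] m T M //=.
case E : (choice T M) => [e|] // Tn Lm LT uL.
have [] := greedy_choice_some E; rewrite inE => /andP[+ _] _.
rewrite inE => /andP[eM eT]; rewrite before_cons inE eq_sym.
have Tn' : (#|T :\ e| <= n)%N by move: Tn; rewrite (cardsD1 e) eT.
have [eL|eL] := boolP (e \in L); last first.
  have eu : e != u by apply: contraNneq eL => ->.
  rewrite (negPf eu) kept_cons (negPf eL) /=.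
  apply: IH => //; apply/fintype.subsetP=> v vLM;
    rewrite !inE (fintype.subsetP LT _ vLM) andbT.
  by apply: contraTneq vLM => ->; rewrite !inE (negPf eL) andbF.
have eLM : e \in L :\: M by rewrite inE eM eL.
have LM : L :\: (e |: M) = (L :\: M) :\ e.
  by apply/setP=> v; rewrite !inE negb_or andbA.
case: m Lm => [|m] Lm; first by move: Lm; rewrite (cardsD1 e) eLM.
rewrite /=; have := greedy_choice_shrink LT eL E; rewrite /choice => ->.
case: eqP => [_|_ /= ut]; first by rewrite kept_nil.
rewrite kept_cons eL; apply: IH => //; rewrite LM.
  by move: Lm; rewrite (cardsD1 e) eLM.
by apply/fintype.subsetP=> v; rewrite !inE => /and3P[-> vM vL];
  apply: (fintype.subsetP LT); rewrite inE vM.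
Qed.

End ConsiderationOrder.

(** * The run for one sample and its link to the online algorithm *)

Section SampledGreedy.
Variables (R : realType) (N : finType) (F : {set {set N}}).
Variables (f : {set N} -> R) (tie : rel N).
Hypothesis F0 : (finset.set0 : {set N}) \in F.
Hypothesis F_down : forall S T : {set N}, S \subset T -> T \in F -> S \in F.
Hypothesis f_submod : submodular f.
Hypothesis tie_order : total_order tie.
Implicit Types (L C M S T : {set N}) (u v e : N) (c : R).

Definition considered L : seq N :=
  consider F f tie L #|N| finset.setT finset.set0.

Definition earlier L u : seq N := before (considered L) u.
Definition held L u : {set N} := [set v in earlier L u | v \in L].
Definition solution L : {set N} := [set v in considered L | v \in L].
Definition weight L u : R := marginal f (held L u) u.

Lemma kept0 L (t : seq N) : kept L finset.set0 t = [set v in t | v \in L].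
Proof. by apply/setP=> v; rewrite !inE. Qed.

Lemma card_setT_le : (#|(finset.setT : {set N})| <= #|N|)%N.
Proof. by rewrite cardsT. Qed.

Lemma considered_uniq L : uniq (considered L).
Proof. exact: consider_uniq. Qed.

Lemma solution_feasible L : solution L \in F.
Proof. by rewrite /solution -kept0; exact: kept_consider_feasible. Qed.

Lemma held_notin L u : u \notin held L u.
Proof. by rewrite inE (negPf (before_notin _ _)). Qed.

Lemma held_sub_solution L u : held L u \subset solution L.
Proof.
by apply/fintype.subsetP=> v; rewrite !inE => /andP[/mem_before-> ->].
Qed.

Lemma considered_candidate L u : u \in considered L ->
  u |: held L u \in F /\ 0 < weight L u.
Proof. by move/consider_candidate; rewrite kept0 !inE => /and3P[]. Qed.

Lemma weight_ge0 L u : u \in considered L -> 0 <= weight L u.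
Proof. by move/considered_candidate=> [_ /ltW]. Qed.

Lemma considered_max L u v : u \in considered L -> v \notin earlier L u ->
  v |: held L u \in F -> marginal f (held L u) v <= weight L u.
Proof.
rewrite /weight /held -!kept0 => ut vu; exact: consider_max.
Qed.

Lemma considered_end L v : v \notin considered L -> v |: solution L \in F ->
  marginal f (solution L) v <= 0.
Proof.
rewrite /solution -!kept0 => vt; apply: consider_end => //.
exact: card_setT_le.
Qed.

Lemma held_mono L u v : v \in earlier L u -> held L v \subset held L u.
Proof.
move=> vu; apply/fintype.subsetP=> x; rewrite !inE => /andP[+ ->].
by rewrite andbT; apply: before_trans.
Qed.

(** When [v] was chosen, [u] was still available, and feasible because [held L v] is contained in
    [held L u]. It was not preferred then, and its marginal only shrinks later. *)
Lemma weight_antitone L u v : u \in considered L -> v \in earlier L u ->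
  weight L u <= weight L v.
Proof.
move=> ut vu; have vt := mem_before vu; have [uF _] := considered_candidate ut.
have vuM := held_mono vu.
apply: le_trans (marginal_antitone f_submod vuM (held_notin L u)) _.
apply: considered_max => //.
  by apply/negP=> uv; have := before_notin (considered L) u;
    rewrite (before_trans vu uv).
by apply: F_down uF; apply: finset.setUS.
Qed.

Definition heavy L c : {set N} := [set u in solution L | c <= weight L u].

(** At the first considered element lighter than [c], the run holds exactly [heavy L c]. If [v]
    fitted there, its marginal of at least [c] would have been preferred; if no element is light,
    [v] would have kept the run from stopping. *)
Lemma unconsidered_blocked_by_heavy L c v : 0 < c -> v \notin considered L ->
  c <= marginal f (solution L) v -> v |: heavy L c \notin F.
Proof.
move=> c_gt0 vt cv; apply/negP=> vF.
have [all_heavy|] := boolP (all (fun u => c <= weight L u) (considered L)).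
  have heavyE : heavy L c = solution L.
    apply/setP=> u; rewrite !inE; case: (boolP (u \in considered L)) => //= ut.
    by rewrite (allP all_heavy u ut) andbT.
  by have := considered_end vt; rewrite -heavyE => /(_ vF);
    rewrite heavyE leNgt (lt_le_trans c_gt0).
rewrite -has_predC => light; pose P u := predC (fun u => c <= weight L u) u.
have [u0 u0t _] := hasP light.
pose u := nth u0 (considered L) (find P (considered L)).
have ut : u \in considered L by rewrite mem_nth // -has_find.
have u_light : weight L u < c by rewrite ltNge; exact: (nth_find u0 light).
(* Since weights decrease along the run, the considered sample elements of weight at least [c] are
   those before the first light element [u]. *)
have heavyE : heavy L c = held L u.
  apply/setP=> x; rewrite !inE; case: (boolP (x \in L)) => xL;
    rewrite ?andbF // !andbT.
  apply/andP/idP=> [[xt xc]|xu].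
    case/or3P: (before_total ut xt) => // [/eqP ux|ux].
      by move: u_light; rewrite ux ltNge xc.
    by move: (weight_antitone xt ux); rewrite leNgt (lt_le_trans u_light xc).
  have xt := mem_before xu; split=> //; move: (xu); rewrite before_index //.
  rewrite [index u _]index_uniq -?has_find // ?considered_uniq // =>
    /(before_find u0).
  by rewrite nth_index //= => /negbFE.
have vu : v \notin earlier L u by apply: contra vt => /mem_before.
have := considered_max ut vu; rewrite -heavyE => /(_ vF); rewrite heavyE.
apply/negP; rewrite -ltNge; apply: lt_le_trans u_light _; apply: le_trans cv _.
apply: marginal_antitone => //; first exact: held_sub_solution.
by rewrite inE (negPf vt).
Qed.

Lemma considered_local L L' u : (forall v, v != u -> (v \in L) = (v \in L')) ->
  [/\ (u \in considered L) = (u \in considered L'),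
      earlier L u = earlier L' u & held L u = held L' u].
Proof.
move=> LL'.
have [E1 E2] := consider_local F f tie #|N| finset.setT finset.set0 LL'.
split=> //; rewrite /held [earlier L u]E1; apply/setP=> v; rewrite !inE.
case: (eqVneq v u) => [->|/LL'->//].
by rewrite (negPf (before_notin _ _)).
Qed.

Lemma considered_setU1 L u :
  [/\ (u \in considered (u |: L)) = (u \in considered L),
      earlier (u |: L) u = earlier L u & held (u |: L) u = held L u].
Proof. by apply: considered_local => v vu; rewrite !inE (negPf vu). Qed.

Lemma greedy_considered L : greedy F f tie L = solution L.
Proof.
rewrite /solution -kept0; apply: iter_greedy_step => //.
- exact: card_setT_le.
- by rewrite finset.setD0.
Qed.

(** The single run for [L] decides for all [u] at once whether greedy on [u |: L] takes [u]. *)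
Lemma greedy_setU1 L u : (u \in greedy F f tie (u |: L)) = (u \in considered L).
Proof.
by have [E _ _] := considered_setU1 L u;
  rewrite greedy_considered !inE eqxx E andbT.
Qed.

Lemma greedy_before_setU1 L u : u \in considered L ->
  greedy_before F f tie (u |: L) u = held L u.
Proof.
have [E1 _ E2] := considered_setU1 L u; rewrite -E1 => ut.
rewrite -E2 /held -kept0; apply: greedy_until_consider => //.
- exact: card_setT_le.
- by rewrite finset.setD0.
- by rewrite !inE eqxx.
Qed.

Lemma eligibleE L C :
  eligible F f tie L C = [set u in considered L | (u \notin L) && (u \in C)].
Proof. by apply/setP=> u; rewrite !inE greedy_setU1 andbCA. Qed.

Lemma surrogate_weightE L C u : surrogate_weight F f tie L C u =
  if u \in eligible F f tie L C then weight L u else 0.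
Proof.
rewrite /surrogate_weight; case: ifP => //;
  rewrite eligibleE inE => /andP[ut _].
by rewrite greedy_before_setU1.
Qed.

Lemma sum_solution_weight L :
  \sum_(u in solution L) weight L u = f (solution L) - f finset.set0.
Proof.
rewrite -(sum_prefix_marginals f L (considered_uniq L)).
rewrite -[RHS]big_filter big_uniq ?filter_uniq ?considered_uniq //=.
by apply: eq_bigl => u; rewrite mem_filter !inE andbC.
Qed.

End SampledGreedy.

(** * Charging arguments for an intersection of matroids *)

Section CommonIndependentSets.
Variables (R : realType) (N : finType) (k : nat) (I : 'I_k -> {set {set N}}).
Variables (f : {set N} -> R) (tie : rel N).
Hypothesis I_matroid : forall i, matroid (I i).
Hypothesis f_submod : submodular f.
Hypothesis tie_order : total_order tie.
Implicit Types (L C Q S T : {set N}) (u v : N) (i : 'I_k).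

Lemma mem_common_independent S :
  (S \in common_independent I) = [forall i, S \in I i].
Proof.
apply/bigcapP/forallP => [SI i|SI i _]; last exact: SI.
exact: SI.
Qed.

Lemma common_independent0 : (finset.set0 : {set N}) \in common_independent I.
Proof.
by rewrite mem_common_independent; apply/forallP=> i; case: (I_matroid i).
Qed.

Lemma common_independentS S T :
  S \subset T -> T \in common_independent I -> S \in common_independent I.
Proof.
rewrite !mem_common_independent => ST /forallP TI; apply/forallP=> i.
by case: (I_matroid i) => _ Isub _; exact: Isub ST (TI i).
Qed.

Local Notation F := (common_independent I).
Local Notation considered := (considered F f tie).
Local Notation earlier := (earlier F f tie).
Local Notation solution := (solution F f tie).
Local Notation weight := (weight F f tie).
Local Notation eligible := (eligible F f tie).
Local Notation heavy := (heavy F f tie).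

Let F0 := common_independent0.
Let Fdown := common_independentS.

Lemma solution_independent i S L : S \subset solution L -> S \in I i.
Proof.
move=> SM; have := Fdown SM (solution_feasible f tie F0 L).
by rewrite mem_common_independent => /forallP.
Qed.

(** Marginals over the solution are charged: a discarded element pays with its own weight, a
    solution element gains nothing, and an unconsidered element of positive marginal is blocked in
    some matroid by solution elements at least as heavy as that marginal. *)
Lemma solution_union_le L T : T \in F ->
  f (solution L :|: T) <= f (solution L)
    + \sum_(u in considered L | u \notin L) weight L u
    + k%:R * \sum_(u in solution L) weight L u.
Proof.
move=> TF; pose M := solution L; pose g := marginal f M.
(* The elements charged to matroid [i]; an element may occur for several [i]. *)
pose B i := [set u in T | [&& u \notin considered L, 0 < g u
                            & u |: heavy L (g u) \notin I i]].
have weight_considered_ge0 u : u \in considered L -> 0 <= weight L u.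
  exact: weight_ge0.
have B_le i : \sum_(u in B i) g u <= \sum_(u in solution L) weight L u.
  apply: sum_le_of_threshold_counts => [u|u|c c_gt0].
  - by rewrite inE => /and4P[].
  - by rewrite inE => /andP[/weight_considered_ge0].
  (* The elements of [B i] above threshold [c] are independent, and all are blocked by solution
     elements of weight at least [c]. *)
  apply: (card_independent_blocked (I_matroid i)) => [|u].
    have [_ Isub _] := I_matroid i; apply: Isub (_ : T \in I i); last first.
      by move: TF; rewrite mem_common_independent => /forallP.
    by apply/fintype.subsetP=> u; rewrite !inE => /andP[/andP[]].
  rewrite 2!inE => /andP[/and4P[_ _ _ uI] cu].
  apply/existsP; exists (heavy L (g u)); rewrite uI andbT; apply/andP; split.
    apply/fintype.subsetP=> v; rewrite !inE => /andP[-> /=].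
    exact: le_trans.
  apply: (@solution_independent _ _ L).
  by apply/fintype.subsetP=> v; rewrite inE => /andP[].
have gain u : u \in T -> g u <=
    (if (u \in considered L) && (u \notin L) then weight L u else 0)
    + \sum_(i < k) (if u \in B i then g u else 0).
  move=> uT.
  have B_ge0 : 0 <= \sum_(i < k) (if u \in B i then g u else 0).
    by apply: sumr_ge0 => i _; case: ifP => //; rewrite inE => /and4P[_ _ /ltW].
  case: ifP => [/andP[ut uL]|].
    rewrite -[leLHS]addr0; apply: lerD => //; apply: marginal_antitone => //.
      exact: held_sub_solution.
    by rewrite inE (negPf uL) andbF.
  rewrite add0r; case: (boolP (u \in considered L)) => ut.
    move=> /negbFE uL; apply: le_trans B_ge0.
    rewrite /g /marginal (_ : u |: M = M) ?subrr //.
    by apply/finset.setUidPr; rewrite finset.sub1set inE ut.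
  move=> _; case: (leP (g u) 0) => [gu|gu]; first exact: le_trans B_ge0.
  have := unconsidered_blocked_by_heavy Fdown f_submod tie_order gu ut (lexx _).
  rewrite mem_common_independent negb_forall => /existsP[i ui].
  rewrite (bigD1 i) //= inE uT ut gu ui /= lerDl.
  by apply: sumr_ge0 => j _; case: ifP => //; rewrite inE => /and4P[_ _ /ltW].
have := union_gain_le_marginals f_submod M T.
have : \sum_(u in T) g u <=
    \sum_(u in considered L | u \notin L) weight L u
      + \sum_(i < k) \sum_(u in B i) g u.
  apply: le_trans (ler_sum _ gain) _; rewrite big_split /=; apply: lerD.
    rewrite -big_mkcondr /= [leRHS](bigID (fun u => u \in T)) /=.
    rewrite -[leLHS]addr0; apply: lerD.
      by rewrite le_eqVlt; apply/orP; left; apply/eqP; apply: eq_bigl => u;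
        rewrite andbC.
    by apply: sumr_ge0 => u /andP[/andP[/weight_considered_ge0]].
  rewrite exchange_big /=; apply: ler_sum => i _.
  rewrite -big_mkcondr /= le_eqVlt; apply/orP; left; apply/eqP;
    apply: eq_bigl => u.
  by rewrite inE andbA andbb.
have : \sum_(i < k) \sum_(u in B i) g u <= k%:R * \sum_(u in solution L) weight
  L u.
  apply: le_trans (ler_sum _ (fun i _ => B_le i)) _.
  by rewrite sumr_const card_ord mulr_natl.
rewrite /g -/M; lra.
Qed.

(** The earlier eligible elements: the name refers to the coins [C], not to the sample [L]. *)
Definition sampled_earlier L C u : {set N} :=
  [set v in earlier L u | (v \notin L) && (v \in C)].

Definition conflict i L C u : bool := blocked (I i) (sampled_earlier L C u) u.

(** Conflicts are tested against all earlier eligible elements, including dropped ones; the test at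
    [u] reads neither its coin nor its membership in [L]. *)
Definition free L C : {set N} :=
  [set u in eligible L C | [forall i, ~~ conflict i L C u]].

Lemma eligible_considered L C u : u \in eligible L C -> u \in considered L.
Proof. by rewrite eligibleE // inE => /andP[]. Qed.

Lemma free_feasible L C : free L C \in F.
Proof.
rewrite mem_common_independent; apply/forallP=> i.
have -> : free L C = [set u in considered L | u \in free L C].
  apply/setP=> u; rewrite inE andbC; case: (boolP (u \in free L C)) => //.
  by rewrite inE => /andP[/eligible_considered ->].
apply: (unblocked_independent (I_matroid i) (Y := eligible L C)).
- exact: considered_uniq.
- by apply/fintype.subsetP=> u; rewrite inE => /andP[].
move=> u ut; rewrite inE => /andP[_ /forallP/(_ i)].
congr (~~ blocked _ _ _); apply/setP=> v; rewrite eligibleE // !inE.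
by case: (boolP (v \in before _ _)) => //= /mem_before ->.
Qed.

(** Conflicting solution elements of weight at least [c] are independent, and their blocking sets
    consist of earlier, hence at least as heavy, eligible elements. *)
Lemma sum_conflict_le i L C :
  \sum_(u in solution L | conflict i L C u) weight L u
    <= \sum_(u in eligible L C) weight L u.
Proof.
rewrite (_ : \sum_(u in _ | _) _ =
    \sum_(u in [set u in solution L | conflict i L C u]) weight L u);
      last first.
  by apply: eq_bigl => u; rewrite [in RHS]inE.
apply: sum_le_of_threshold_counts => [u|u /eligible_considered|c c_gt0].
- by rewrite 2!inE => /andP[/andP[/(considered_candidate)[]]].
- exact: weight_ge0.
apply: (card_independent_blocked (I_matroid i)) => [|u].
  apply: (@solution_independent _ _ L).
  by apply/fintype.subsetP=> u; rewrite 2!inE => /andP[/andP[]].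
rewrite 3!inE => /andP[/andP[/andP[ut uL] uc] cu].
apply: blockedS uc; apply/fintype.subsetP=> v.
rewrite [v \in sampled_earlier _ _ _]inE => /andP[vu vLC];
  rewrite inE eligibleE // inE (mem_before vu) vLC /=.
by apply: le_trans cu _; exact: weight_antitone.
Qed.

(** For eligible [u], a lower bound on its marginal over whichever earlier eligible elements are
    finally output. *)
Definition late_weight L C u : R :=
  marginal f [set v in earlier L u | v \in L :|: C] u.

Lemma late_weight_le L C u : late_weight L C u <= weight L u.
Proof.
apply: marginal_antitone => //.
  by apply/fintype.subsetP=> v; rewrite !inE => /andP[-> ->].
by rewrite inE (negPf (before_notin _ _)).
Qed.

(** The output value telescopes along the run into marginals that are at least the late weights.
    Weight minus late weight is nonnegative, so the loss may be summed over all eligible elements,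
    which frees it from [Q]. *)
Lemma selected_value_ge L C Q :
  f finset.set0 + \sum_(u in Q) surrogate_weight F f tie L C u
    - \sum_(u in eligible L C) (weight L u - late_weight L C u)
  <= f (Q :&: eligible L C).
Proof.
set E := eligible L C; set QE := Q :&: E.
have QE_considered u : u \in QE -> u \in considered L.
  by rewrite inE => /andP[_ /eligible_considered].
have -> : \sum_(u in Q) surrogate_weight F f tie L C u = \sum_(u in QE) weight
  L u.
  under eq_bigr do rewrite surrogate_weightE //.
  by rewrite -big_mkcondr; apply: eq_bigl => u; rewrite /QE finset.in_setI.
have sum_QE (h : N -> R) : \sum_(u <- considered L | u \in QE) h u = \sum_(u in
  QE) h u.
  rewrite -big_filter big_uniq ?filter_uniq ?considered_uniq //=.
  apply: eq_bigl => u; rewrite mem_filter.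
  by case: (boolP (u \in QE)) => //= /QE_considered ->.
have := sum_prefix_marginals f QE (considered_uniq F f tie L).
rewrite sum_QE.
have -> : [set u in considered L | u \in QE] = QE.
  apply/setP=> u; rewrite inE andbC.
  by case: (boolP (u \in QE)) => //= /QE_considered ->.
have : \sum_(u in QE) late_weight L C u
    <= \sum_(u in QE) marginal f [set v in before (considered L) u | v \in QE]
      u.
  apply: ler_sum => u uQE; apply: marginal_antitone => //.
    apply/fintype.subsetP=> v; rewrite inE => /andP[vu vQE].
    rewrite inE vu /=; move: vQE; rewrite inE => /andP[_].
    by rewrite /E eligibleE // !inE => /and3P[_ _ ->]; rewrite orbT.
  by rewrite inE (negPf (before_notin _ _)).
have : \sum_(u in QE) (weight L u - late_weight L C u)
    <= \sum_(u in E) (weight L u - late_weight L C u).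
  rewrite [leRHS](bigID (fun u => u \in Q)) /= -[leLHS]addr0; apply: lerD.
    by rewrite le_eqVlt; apply/orP; left; apply/eqP; apply: eq_bigl => u;
      rewrite /QE finset.in_setI andbC.
  by apply: sumr_ge0 => u _; rewrite subr_ge0 late_weight_le.
by rewrite sumrB; lra.
Qed.

(** Telescoping over the considered elements of [L :|: C]: those in [L] form the solution, the
    others are eligible. *)
Lemma sum_late_weight L C :
  \sum_(u in solution L) late_weight L C u
    + \sum_(u in eligible L C) late_weight L C u
  = f (solution L :|: (C :&: [set u in considered L])) - f finset.set0.
Proof.
have := sum_prefix_marginals f (L :|: C) (considered_uniq F f tie L).
have -> : [set u in considered L | u \in L :|: C]
    = solution L :|: (C :&: [set u in considered L]).
  by apply/setP=> u; rewrite !inE; case: (u \in considered L);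
    rewrite ?andbF ?andbT.
move=> <-; rewrite [RHS](bigID (fun u => u \in L)) /=.
have sum_t (P : pred N) (h : N -> R) :
    \sum_(u <- considered L | P u) h u = \sum_(u in considered L | P u) h u.
  rewrite -big_filter big_uniq ?filter_uniq ?considered_uniq //=.
  by apply: eq_bigl => u; rewrite mem_filter andbC.
rewrite !sum_t; congr (_ + _); apply: eq_bigl => u.
  by rewrite !inE; case: (u \in L); rewrite ?andbF.
by rewrite eligibleE // !inE; case: (u \in L); rewrite ?andbF //= ?andbT.
Qed.

End CommonIndependentSets.

(** * From arrival orders and slots to samples and input orders *)

Section Resampling.
Variables (R : realType) (N : finType).
Implicit Type L : {set N}.

Lemma interleave_filter (P : pred N) (s : seq N) :
  interleave (map P s) (seq.filter P s) (seq.filter (predC P) s) = s.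
Proof. by elim: s => //= u s IH; case: (P u) => /=; rewrite IH. Qed.

Lemma interleaveK (P : pred N) (b : bitseq) (l r : seq N) :
  count id b = size l -> count negb b = size r ->
  all P l -> all (predC P) r ->
  [/\ map P (interleave b l r) = b, seq.filter P (interleave b l r) = l
    & seq.filter (predC P) (interleave b l r) = r].
Proof.
elim: b l r => [|[] b IH] [|v l] [|u r] //=; rewrite ?add0n ?add1n //.
- move=> [bl] br /andP[vP lP] rP; have [//|//|//|//|-> -> ->] := IH l [::].
  by rewrite vP.
- move=> [bl] br /andP[vP lP] rP; have [//|//|//|//|-> -> ->] := IH l (u :: r).
  by rewrite vP.
- move=> bl [br] lP /andP[uP rP]; have [//|//|//|//|-> -> ->] := IH [::] r.
  by rewrite uP (negPf uP).
- move=> bl [br] lP /andP[uP rP]; have [//|//|//|//|-> -> ->] := IH (v :: l) r.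
  by rewrite uP (negPf uP).
Qed.

Lemma arrival_orders_neq0 : (0 < #|arrival_orders N|)%N.
Proof.
rewrite card_gt0; apply/set0Pn; exists (enum_tuple N).
by rewrite inE /= enum_uniq.
Qed.

Lemma mem_arrival_order (s : #|N|.-tuple N) u : uniq s -> u \in s.
Proof.
move=> s_uniq.
have [||_ ->] := @uniq_min_size _ s (enum N) s_uniq; last by rewrite mem_enum.
  by move=> v _; rewrite mem_enum.
by rewrite -cardE size_tuple.
Qed.

Lemma count_arrival_order (s : #|N|.-tuple N) L : uniq s ->
  count (fun u => u \in L) s = #|L|.
Proof.
move=> s_uniq; rewrite -size_filter -(card_uniqP (filter_uniq _ s_uniq)).
by apply: eq_card => u; rewrite mem_filter mem_arrival_order // andbT.
Qed.

Lemma sample_first_subproof L (s : #|N|.-tuple N) :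
  size (seq.filter (fun u => u \in L) s ++ seq.filter (predC (fun u => u \in
    L)) s) == #|N|.
Proof. by rewrite size_cat !size_filter count_predC size_tuple. Qed.

Definition sample_first L (s : #|N|.-tuple N) : #|N|.-tuple N :=
  Tuple (sample_first_subproof L s).

(** A bijection: a sample [L] and an input order determine the arrival order listing [L] first and
    the slots of [L] in the input; interleaving inverts this. *)
Lemma sum_interleave (x : nat) (H : {set N} -> seq N -> R) : (x <= #|N|)%N ->
  \sum_(s in arrival_orders N) \sum_(b in slot_patterns N x)
     H [set u in take x s] (interleave b (take x s) (drop x s))
  = \sum_(L : {set N} | #|L| == x) \sum_(s in arrival_orders N) H L s.
Proof.
move=> xN; rewrite !pair_big /=.
pose h (j : {set N} * #|N|.-tuple N) :=
  (sample_first j.1 j.2, map_tuple (fun u => u \in j.1) j.2).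
(* The default of [insubd] never occurs in the sum: with [x] slots the interleaving has length
   [#|N|]. *)
pose h' (i : #|N|.-tuple N * #|N|.-tuple bool) :=
  ([set u in take x i.1],
   insubd i.1 (interleave i.2 (take x i.1) (drop x i.1))).
rewrite (reindex_onto h h') /=; last first.
  move=> [s b] /andP[]; rewrite !inE /= => s_uniq /eqP bx.
  set P := fun u => u \in [set u in take x s].
  have lP : all P (take x s) by apply/allP=> u; rewrite /P inE.
  have rP : all (predC P) (drop x s).
    apply/allP=> u ur; rewrite /= /P inE; apply/negP=> ul.
    move: s_uniq; rewrite -{1}(cat_take_drop x s) cat_uniq => /and3P[_ /hasPn +
      _].
    by move/(_ u ur)/negP; apply.
  have sl : size (take x s) = x by rewrite size_takel // size_tuple.
  have br : count negb b = size (drop x s).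
    have := count_predC id b; rewrite size_tuple bx size_drop size_tuple.
    by move/(congr1 (subn^~ x)); rewrite addKn.
  have bl : count id b = size (take x s) by rewrite sl.
  have [E1 E2 E3] := interleaveK bl br lP rP.
  have sz : size (interleave b (take x s) (drop x s)) == #|N|.
    by rewrite -(size_map P) E1 size_tuple.
  congr pair; apply: val_inj; rewrite /= val_insubd sz //.
  by rewrite E2 E3 cat_take_drop.
have hE j : ((h j).1 \in arrival_orders N) && ((h j).2 \in slot_patterns N x)
    = (#|j.1| == x) && (j.2 \in arrival_orders N).
  case: j => L s; rewrite /= !inE /= (perm_uniq (permEl (perm_filterC _ s))).
  rewrite count_map andbC; case: (boolP (uniq s)) => s_uniq;
    rewrite ?andbF // !andbT.
  by rewrite -(count_arrival_order L s_uniq).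
have key L (s : #|N|.-tuple N) : #|L| = x -> uniq s ->
    take x (sample_first L s) = seq.filter (fun u => u \in L) s
    /\ drop x (sample_first L s) = seq.filter (predC (fun u => u \in L)) s.
  move=> Lx s_uniq; have sx : size (seq.filter (fun u => u \in L) s) = x.
    by rewrite size_filter count_arrival_order.
  by rewrite /= take_size_cat // drop_size_cat.
have setE L (s : #|N|.-tuple N) : uniq s -> [set u in seq.filter (fun u => u
  \in L) (tval s)] = L.
  by move=> s_uniq; apply/setP=> u;
    rewrite inE mem_filter mem_arrival_order // andbT.
apply: eq_big => [j|j /andP[]].
  rewrite hE; case: j => L s /=; rewrite inE.
  case: (boolP ((#|L| == x) && uniq s)) => //= /andP[/eqP Lx s_uniq].
  have [tE dE] := key L s Lx s_uniq; apply/eqP; rewrite /h'.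
  rewrite [tval _]/= in tE dE.
  congr pair; rewrite /= ?tE ?dE ?setE //.
  by apply: val_inj; rewrite val_insubd interleave_filter size_tuple eqxx.
rewrite hE; case: j => L s /=; rewrite inE => /andP[/eqP Lx s_uniq] _.
have [tE dE] := key L s Lx s_uniq; rewrite [tval _]/= in tE dE.
by rewrite tE dE setE // interleave_filter.
Qed.

(** Double counting: [sum_interleave] with summand 1, divided by the number of arrival orders. *)
Lemma card_slot_patterns (x : nat) : (x <= #|N|)%N ->
  #|slot_patterns N x| = 'C(#|N|, x).
Proof.
move=> xN; apply/eqP; rewrite -(eqn_pmul2l arrival_orders_neq0) -(eqr_nat R).
have := sum_interleave (fun _ _ => 1) xN; rewrite !sumr_const.
rewrite (eq_card (B := pred_of_set [set L : {set N} | #|L| == x])); last first.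
  by move=> L; rewrite !inE.
by move=> E; rewrite !natrM [X in X == _]mulr_natl E card_draws mulr_natr.
Qed.

Lemma coin_prob_half L : coin_prob (2^-1 : R) L = 2^-1 ^+ #|N|.
Proof.
rewrite /coin_prob -prodr_const; apply: eq_big => // u _.
by rewrite /bernoulli_pmf; case: ifP => // _; field.
Qed.

(* Together the arrival order, the sample size and the slots carry the same
   information as the sample and the input order of the linear algorithm, and
   the latter two are independent. *)
Lemma mean_resample (H : {set N} -> seq N -> R) :
  uniform_mean (arrival_orders N) (fun s =>
    \sum_(x < #|N|.+1) binomial_pmf #|N| (2^-1) x *
      uniform_mean (slot_patterns N x) (fun b =>
        H [set u in take x s] (interleave b (take x s) (drop x s))))
  = \sum_(L : {set N}) coin_prob 2^-1 L *
      uniform_mean (arrival_orders N) (fun s => H L s).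
Proof.
rewrite /uniform_mean; under [RHS]eq_bigr do rewrite coin_prob_half mulrCA.
rewrite -mulr_sumr; congr (_ * _); rewrite exchange_big /=.
rewrite (partition_big (fun L : {set N} => inord #|L| : 'I_#|N|.+1) predT) //=.
apply: eq_bigr => x _; have xN : (x <= #|N|)%N by rewrite -ltnS.
rewrite -mulr_sumr -mulr_sumr -(mulr_sumr _ _ _ (2^-1 ^+ _)).
under [X in _ = _ * X]eq_bigl => L.
  rewrite -val_eqE /= inordK ?ltnS ?max_card //.
  over.
rewrite -sum_interleave // mulrA; congr (_ * _).
(* The binomial coefficient cancels against the number of slot patterns, leaving the same
   probability for every sample. *)
rewrite /binomial_pmf card_slot_patterns //.
have -> : unstable.onem (2^-1 : R) = 2^-1 by rewrite /unstable.onem; field.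
rewrite -exprD subnKC // -mulr_natr -mulrA mulfV ?mulr1 //.
by rewrite pnatr_eq0 -lt0n bin_gt0.
Qed.

End Resampling.

(** * Measurability and integrals over the seed *)

Section RandomizedSelection.
Variables (R : realType) (N : finType).
Variables (d : measure_display) (Omega : measurableType d).
Variables (P : probability Omega R) (A : Omega -> online_rule R N).
Hypothesis A_measurable : forall h, measurable_fun setT (fun o => A o h).

(** Generality in [G] lets the induction absorb the first decision into a function of the remaining
    selection. *)
Lemma measurable_select_from (G : {set N} -> R) (past todo : seq (N * R)) :
  measurable_fun setT (fun o => G (select_from (A o) past todo)).
Proof.
elim: todo G past => [|x todo IH] G past /=; first exact: measurable_cst.
pose G1 S := G ([set x.1] :|: S); pose G0 S := G (finset.set0 :|: S).
rewrite (_ : (fun o => _) = fun o => if A o (rcons past x)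
    then G1 (select_from (A o) (rcons past x) todo)
    else G0 (select_from (A o) (rcons past x) todo)); last first.
  by apply/funext => o; case: (A o _).
by apply: measurable_fun_ifT; [exact: A_measurable|exact: IH|exact: IH].
Qed.

Lemma integrable_selected (G : {set N} -> R) (w : N -> R) (s : seq N) :
  P.-integrable setT (EFin \o (fun o => G (selected (A o) w s))).
Proof.
apply: measurable_bounded_integrable.
- exact: measurableT.
- by rewrite [X in (X < _)%E](_ : _ = 1%E) ?ltry //; exact: probability_setT.
- exact: measurable_select_from.
(* The selection takes finitely many values, so this sum bounds [G] at all of them. *)
exists (\sum_(S : {set N}) `|G S|); split; first exact: num_real.
move=> B GB o _ /=; apply: le_trans (ltW GB).
rewrite (bigD1 (selected (A o) w s)) //= lerDl.
by apply: sumr_ge0.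
Qed.

Lemma integral_selected_ge (G : {set N} -> R) (w : N -> R) (c : R) (s : seq N) :
  (forall Q : {set N}, c + \sum_(u in Q) w u <= G Q) ->
  c + \int[P]_o (\sum_(u in selected (A o) w s) w u)
    <= \int[P]_o G (selected (A o) w s).
Proof.
move=> cG; pose W (Q : {set N}) := \sum_(u in Q) w u.
have -> : c = \int[P]_(o in setT) c.
  rewrite Rintegral_cst // [X in fine X](_ : _ = 1%E) ?mulr1 //.
  exact: probability_setT.
rewrite -RintegralD //; last 2 first.
- exact: (integrable_selected (fun=> c) w s).
- exact: (integrable_selected W w s).
apply: le_Rintegral => //.
- exact: (integrable_selected (fun Q => c + W Q) w s).
- exact: (integrable_selected G w s).
Qed.

End RandomizedSelection.

(** * Expectation over the sample and the coins *)

Section SampleMean.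
Variables (R : realType) (N : finType) (p : R).
Hypothesis p01 : 0 <= p <= 1.
Implicit Types (L C : {set N}) (g h : {set N} -> {set N} -> R).

Local Notation mu := (coin_prob (2^-1 : R)).

Definition sample_mean h : R :=
  \sum_(L : {set N}) mu L * \sum_(C : {set N}) coin_prob p C * h L C.

Let mu_ge0 L : 0 <= mu L.
Proof. by apply: coin_prob_ge0; lra. Qed.

Lemma sample_meanD g h :
  sample_mean (fun L C => g L C + h L C) = sample_mean g + sample_mean h.
Proof.
rewrite /sample_mean -big_split /=; apply: eq_bigr => L _.
rewrite -mulrDr -big_split /=; congr (_ * _).
by apply: eq_bigr => C _; rewrite mulrDr.
Qed.

Lemma sample_meanZ (a : R) h :
  sample_mean (fun L C => a * h L C) = a * sample_mean h.
Proof.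
rewrite /sample_mean mulr_sumr; apply: eq_bigr => L _.
rewrite mulrCA; congr (_ * _); rewrite mulr_sumr.
by apply: eq_bigr => C _; rewrite mulrCA.
Qed.

Lemma sample_mean_sum (J : finType) (h : J -> {set N} -> {set N} -> R) :
  sample_mean (fun L C => \sum_j h j L C) = \sum_j sample_mean (h j).
Proof.
rewrite /sample_mean exchange_big /=; apply: eq_bigr => L _.
rewrite -mulr_sumr; congr (_ * _); rewrite exchange_big /=.
by apply: eq_bigr => C _; rewrite mulr_sumr.
Qed.

Lemma sample_mean_sample (g : {set N} -> R) :
  sample_mean (fun L _ => g L) = \sum_(L : {set N}) mu L * g L.
Proof.
by apply: eq_bigr => L _; rewrite -mulr_suml sum_coin_prob mul1r.
Qed.

Lemma sample_mean_const (a : R) : sample_mean (fun _ _ => a) = a.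
Proof. by rewrite sample_mean_sample -mulr_suml sum_coin_prob mul1r. Qed.

Lemma ler_sample_mean g h : (forall L C, g L C <= h L C) ->
  sample_mean g <= sample_mean h.
Proof.
move=> gh; apply: ler_sum => L _; apply: ler_wpM2l => //.
by apply: ler_sum => C _; apply: ler_wpM2l => //; exact: coin_prob_ge0.
Qed.

(** As [g L u] ignores the membership of [u], the element is equally likely inside and outside
    [L]. *)
Lemma sum_sample_swap (g : {set N} -> N -> R) :
  (forall L u, g (u |: L) u = g L u) ->
  \sum_(L : {set N}) mu L * \sum_(u | u \notin L) g L u
    = \sum_(L : {set N}) mu L * \sum_(u in L) g L u.
Proof.
move=> gu.
under eq_bigr do rewrite mulr_sumr; under [RHS]eq_bigr do rewrite mulr_sumr.
rewrite (exchange_big_dep xpredT) // [RHS](exchange_big_dep xpredT) //=.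
apply: eq_bigr => u _.
have half := coin_independence (2^-1 : R) (fun L => gu L u).
have total : \sum_(L : {set N}) mu L * g L u
    = \sum_(L : {set N} | u \in L) mu L * g L u
      + \sum_(L : {set N} | u \notin L) mu L * g L u.
  by rewrite [LHS](bigID (fun L : {set N} => u \in L)).
by rewrite total in half; lra.
Qed.

(** As in [sum_sample_swap], while the coin of [u], independent of [g], contributes the factor
    [p]. *)
Lemma sample_mean_swap (g : {set N} -> {set N} -> N -> R) :
  (forall L C u, g (u |: L) C u = g L C u) ->
  (forall L C u, g L (u |: C) u = g L C u) ->
  sample_mean (fun L C => \sum_(u | (u \notin L) && (u \in C)) g L C u)
    = p * sample_mean (fun L C => \sum_(u in L) g L C u).
Proof.
move=> gL gC; pose G L u := \sum_(C : {set N}) coin_prob p C * g L C u.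
have sumG (P : pred N) L :
    \sum_(C : {set N}) coin_prob p C * \sum_(u | P u) g L C u = \sum_(u | P u)
      G L u.
  under eq_bigr do rewrite mulr_sumr.
  by rewrite exchange_big.
transitivity (\sum_(L : {set N}) mu L * \sum_(u | u \notin L) p * G L u).
  apply: eq_bigr => L _; congr (_ * _); under eq_bigr do rewrite mulr_sumr.
  rewrite (exchange_big_dep (fun u => u \notin L)) /=;
    last by move=> C u _ /andP[].
  apply: eq_bigr => u uL; rewrite -(coin_independence p (fun C => gC L C u)).
  by apply: eq_bigl => C; rewrite uL.
rewrite sum_sample_swap => [|L u]; last by congr (_ * _);
  apply: eq_bigr => C _; rewrite gL.
rewrite /sample_mean mulr_sumr; apply: eq_bigr => L _.
by rewrite sumG -mulr_sumr mulrCA.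
Qed.

End SampleMean.

(** * Expected values along the run *)

Section ExpectedValue.
Variables (R : realType) (N : finType) (k : nat) (I : 'I_k -> {set {set N}}).
Variables (f : {set N} -> R) (tie : rel N).
Hypothesis I_matroid : forall i, matroid (I i).
Hypothesis f_ge0 : forall S, 0 <= f S.
Hypothesis f_submod : submodular f.
Hypothesis tie_order : total_order tie.
Variable p : R.
Hypothesis p01 : 0 <= p <= 1.
Implicit Types (L C S T : {set N}).

Local Notation F := (common_independent I).
Local Notation considered := (considered F f tie).
Local Notation solution := (solution F f tie).
Local Notation weight := (weight F f tie).
Local Notation late_weight := (late_weight I f tie).
Local Notation conflict := (conflict I f tie).
Local Notation eligible := (eligible F f tie).
Local Notation mu := (coin_prob (2^-1 : R)).

Let mu_ge0 L : 0 <= mu L.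
Proof. by apply: coin_prob_ge0; lra. Qed.

(** Whether [u] is considered does not depend on its membership in [L], so [sample_mean_swap]
    applies after extending the summand by zero. *)
Lemma sample_mean_eligible (g : {set N} -> {set N} -> N -> R) :
  (forall L C u, g (u |: L) C u = g L C u) ->
  (forall L C u, g L (u |: C) u = g L C u) ->
  sample_mean p (fun L C => \sum_(u in eligible L C) g L C u)
    = p * sample_mean p (fun L C => \sum_(u in solution L) g L C u).
Proof.
move=> gL gC; pose h L C u := if u \in considered L then g L C u else 0.
have hL L C u : h (u |: L) C u = h L C u.
  by rewrite /h gL; have [-> _ _] := considered_setU1 F f tie L u.
have hC L C u : h L (u |: C) u = h L C u by rewrite /h gC.
rewrite (_ : (fun L C => \sum_(u in eligible L C) g L C u) =
    fun L C => \sum_(u | (u \notin L) && (u \in C)) h L C u); last first.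
  apply/funext => L; apply/funext => C; rewrite /h -big_mkcondr /=.
  by apply: eq_bigl => u; rewrite eligibleE // inE andbC.
rewrite sample_mean_swap //; congr (_ * sample_mean p _).
apply/funext => L; apply/funext => C; rewrite /h -big_mkcondr /=.
by apply: eq_bigl => u; rewrite inE andbC.
Qed.

Lemma weight_setU1 L u : weight (u |: L) u = weight L u.
Proof. by rewrite /weight; have [_ _ ->] := considered_setU1 F f tie L u. Qed.

Lemma sum_unsampled_weight :
  \sum_(L : {set N}) mu L * \sum_(u in considered L | u \notin L) weight L u
    = \sum_(L : {set N}) mu L * \sum_(u in solution L) weight L u.
Proof.
pose h L u := if u \in considered L then weight L u else 0.
transitivity (\sum_(L : {set N}) mu L * \sum_(u | u \notin L) h L u).
  apply: eq_bigr => L _; rewrite -big_mkcondr /=.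
  by congr (_ * _); apply: eq_bigl => u; rewrite andbC.
rewrite sum_sample_swap => [|L u].
  apply: eq_bigr => L _; rewrite -big_mkcondr /=.
  by congr (_ * _); apply: eq_bigl => u; rewrite inE andbC.
by rewrite /h weight_setU1; have [-> _ _] := considered_setU1 F f tie L u.
Qed.

(** This is [sampling_lower_bound] for [f (S :|: T)] as a function of [S]: the solution lies in [L],
    so each element has probability at most one half. *)
Lemma expected_solution_union_ge T :
  2^-1 * f T <= \sum_(L : {set N}) mu L * f (solution L :|: T).
Proof.
pose g S := f (S :|: T).
have g_submod : submodular g.
  move=> S S'; rewrite /g; have := f_submod (S :|: T) (S' :|: T).
  rewrite (_ : (S :|: T) :|: _ = (S :|: S') :|: T); last first.
    by apply/setP=> u; rewrite !inE; case: (u \in T); rewrite ?orbT ?orbF.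
  by rewrite (_ : (S :|: T) :&: _ = (S :&: S') :|: T) // -finset.setUIl.
have := sampling_lower_bound (X := solution) g_submod (fun S => f_ge0 _) mu_ge0
  (sum_coin_prob N _) (p := 2^-1).
rewrite /g finset.set0U (_ : 1 - 2^-1 = 2^-1 :> R); last by field.
apply; first by rewrite invr_ge0.
move=> u; apply: sum_coin_prob_subset_le => [|L]; first by lra.
by apply/fintype.subsetP=> v; rewrite inE => /andP[].
Qed.

Lemma expected_solution_with_coins_ge L :
  (1 - p) * f (solution L) <= \sum_(C : {set N}) coin_prob p C *
    f (solution L :|: (C :&: [set u in considered L])).
Proof.
pose g S := f (solution L :|: S).
have g_submod : submodular g.
  move=> S S'; rewrite /g; have := f_submod (solution L :|: S) (solution L :|:
    S').
  rewrite (_ : (_ :|: S) :|: _ = solution L :|: (S :|: S')); last first.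
    by apply/setP=> u; rewrite !inE; case: (u \in considered L);
      case: (u \in L); rewrite ?orbT.
  by rewrite (_ : (_ :|: S) :&: _ = solution L :|: (S :&: S')) //
    -finset.setUIr.
have := sampling_lower_bound (X := fun C => C :&: [set u in considered L])
  g_submod (fun S => f_ge0 _) (fun C => coin_prob_ge0 C p01) (sum_coin_prob N
    p).
rewrite /g finset.setU0; apply; first by case/andP: p01.
move=> u; apply: sum_coin_prob_subset_le => // C.
exact: finset.subsetIl.
Qed.

Let X : R := \sum_(L : {set N}) mu L * \sum_(u in solution L) weight L u.

Lemma expected_solution_weight_ge0 : 0 <= X.
Proof.
apply: sumr_ge0 => L _; apply: mulr_ge0 => //; apply: sumr_ge0 => u.
rewrite inE => /andP[ut _].
exact: weight_ge0.
Qed.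

Lemma expected_solution_value :
  \sum_(L : {set N}) mu L * f (solution L) = X + f finset.set0.
Proof.
have -> : f finset.set0 = \sum_(L : {set N}) mu L * f finset.set0.
  by rewrite -mulr_suml sum_coin_prob mul1r.
rewrite -big_split /=; apply: eq_bigr => L _.
by rewrite -mulrDr (sum_solution_weight F f tie) subrK.
Qed.

(** In [solution_union_le] the solution contributes [X] plus the value of the empty set, the
    discarded elements contribute another [X], and the matroids contribute [k] times [X]. *)
Lemma expected_solution_weight_ge T : T \in F ->
  2^-1 * f T <= (k%:R + 2%:R) * X + f finset.set0.
Proof.
move=> TF; apply: le_trans (expected_solution_union_ge T) _.
have : \sum_(L : {set N}) mu L * f (solution L :|: T) <=
    \sum_(L : {set N}) mu L * (f (solution L)
    + \sum_(u in considered L | u \notin L) weight L u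
    + k%:R * \sum_(u in solution L) weight L u).
  by apply: ler_sum => L _; apply: ler_wpM2l => //; exact: solution_union_le.
move/le_trans; apply.
under eq_bigr do rewrite !mulrDr mulrCA.
rewrite !big_split /= -mulr_sumr sum_unsampled_weight expected_solution_value
  -/X.
by lra.
Qed.

Lemma expected_eligible_weight :
  sample_mean p (fun L C => \sum_(u in eligible L C) weight L u) = p * X.
Proof.
rewrite (sample_mean_eligible (g := fun L _ u => weight L u)) //.
  by rewrite sample_mean_sample.
by move=> L C u; exact: weight_setU1.
Qed.

Lemma sampled_earlier_setU1l L C u :
  sampled_earlier I f tie (u |: L) C u = sampled_earlier I f tie L C u.
Proof.
apply/setP=> v; rewrite !inE; have [_ -> _] := considered_setU1 F f tie L u.
by case: eqP => // ->; rewrite (negPf (before_notin _ _)).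
Qed.

Lemma sampled_earlier_setU1r L C u :
  sampled_earlier I f tie L (u |: C) u = sampled_earlier I f tie L C u.
Proof.
apply/setP=> v; rewrite !inE.
by case: eqP => // ->; rewrite (negPf (before_notin _ _)).
Qed.

(* Given the run before [u], an unsampled [u] is eligible with probability
   [p], and [u] is as likely to be sampled as not, so conflicts of eligible
   elements can be counted on the independent set [solution L]. *)
Lemma expected_conflict_le i :
  sample_mean p (fun L C => \sum_(u in eligible L C)
    if conflict i L C u then weight L u else 0) <= p * (p * X).
Proof.
rewrite (sample_mean_eligible (g := fun L C u => if conflict i L C u then
  weight L u else 0)).
- case/andP: p01 => p0 _; apply: ler_wpM2l => //.
  rewrite -expected_eligible_weight; apply: ler_sample_mean => // L C.
  by rewrite -big_mkcondr; exact: sum_conflict_le.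
- by move=> L C u; rewrite /conflict sampled_earlier_setU1l weight_setU1.
- by move=> L C u; rewrite /conflict sampled_earlier_setU1r.
Qed.

Let D : R := sample_mean p (fun L C => \sum_(u in solution L) late_weight L C
  u).

Lemma expected_eligible_late_weight :
  sample_mean p (fun L C => \sum_(u in eligible L C) late_weight L C u) = p * D.
Proof.
apply: sample_mean_eligible => L C u; rewrite /late_weight; congr marginal.
  apply/setP=> v; rewrite !inE; have [_ -> _] := considered_setU1 F f tie L u.
  by case: eqP => // ->; rewrite (negPf (before_notin _ _)).
apply/setP=> v; rewrite !inE.
by case: eqP => // ->; rewrite (negPf (before_notin _ _)).
Qed.

(** The late weights of the solution and of the eligible elements, with means [D] and [p * D], add
    up to the gain of the solution enlarged by coin-marked elements. *)
Lemma expected_late_weight_ge :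
  (1 - p) * (X + f finset.set0) - f finset.set0 <= (1 + p) * D.
Proof.
rewrite [leRHS]mulrDl mul1r -expected_eligible_late_weight /D -sample_meanD.
rewrite (_ : (fun L C => _) = fun L C =>
    f (solution L :|: (C :&: [set u in considered L])) + -1 * f finset.set0);
      last first.
  by apply/funext => L; apply/funext => C; rewrite sum_late_weight // mulN1r.
rewrite sample_meanD sample_mean_const mulN1r lerD2r -expected_solution_value.
rewrite mulr_sumr; apply: ler_sum => L _; rewrite mulrCA;
  apply: ler_wpM2l => //.
exact: expected_solution_with_coins_ge.
Qed.

(** Here [V] stands for the value obtained given sample and coins. Passing from eligible to free
    elements loses at most the conflicting weight, summed over the matroids in [Z]. *)
Lemma sample_mean_secretary_ge (alpha : R) (V : {set N} -> {set N} -> R) :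
  0 <= alpha ->
  (forall L C, f finset.set0
     + alpha * \sum_(u in free I f tie L C) weight L u
     - \sum_(u in eligible L C) (weight L u - late_weight L C u) <= V L C) ->
  f finset.set0 + alpha * (p * X - k%:R * (p * (p * X))) - p * X + p * D
    <= sample_mean p V.
Proof.
move=> alpha_ge0 V_ge.
pose Z L C := \sum_(i < k) \sum_(u in eligible L C)
  if conflict i L C u then weight L u else 0.
have free_ge L C : \sum_(u in eligible L C) weight L u - Z L C
    <= \sum_(u in free I f tie L C) weight L u.
  rewrite /Z exchange_big /= -sumrB.
  rewrite [leRHS](eq_bigl (fun u => (u \in eligible L C)
      && [forall i, ~~ conflict i L C u])) => [|u]; last by rewrite [LHS]inE.
  rewrite big_mkcondr /=; apply: ler_sum => u /(eligible_considered tie_order)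
    ut.
  have w_ge0 : 0 <= weight L u by exact: weight_ge0.
  case: forallP => [_|].
    by rewrite gerBl; apply: sumr_ge0 => i _; case: ifP.
  (* A dropped element conflicts in some matroid [i], and that term of [Z] alone cancels its
     weight. *)
  move/forallP; rewrite negb_forall => /existsP[i]; rewrite negbK => ui.
  rewrite subr_le0 (bigD1 i) //= ui lerDl.
  by apply: sumr_ge0 => j _; case: ifP.
have : sample_mean p (fun L C => f finset.set0
     + alpha * (\sum_(u in eligible L C) weight L u + -1 * Z L C)
     + -1 * \sum_(u in eligible L C) weight L u
     + \sum_(u in eligible L C) late_weight L C u) <= sample_mean p V.
  apply: ler_sample_mean => // L C; apply: le_trans (V_ge L C).
  have := ler_wpM2l alpha_ge0 (free_ge L C); rewrite (sumrB _ _ (weight L));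
    lra.
rewrite !sample_meanD !sample_meanZ sample_meanD sample_meanZ sample_mean_const.
rewrite expected_eligible_weight expected_eligible_late_weight sample_mean_sum.
have : \sum_(i < k) sample_mean p (fun L C => \sum_(u in eligible L C)
    if conflict i L C u then weight L u else 0) <= k%:R * (p * (p * X)).
  apply: le_trans (ler_sum _ (fun i _ => expected_conflict_le i)) _.
  by rewrite sumr_const card_ord mulr_natl.
move/(ler_wpM2l alpha_ge0); lra.
Qed.

End ExpectedValue.

(** * Averages over a finite set *)

Section UniformMeans.
Variables (R : realType) (T : finType) (B : {set T}).
Implicit Types g h : T -> R.

Lemma uniform_mean_sum (J : finType) (a : J -> R) (g : J -> T -> R) :
  uniform_mean B (fun x => \sum_j a j * g j x)
    = \sum_j a j * uniform_mean B (g j).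
Proof.
rewrite /uniform_mean exchange_big mulr_sumr; apply: eq_bigr => j _.
by rewrite -mulr_sumr mulrCA.
Qed.

Lemma ler_uniform_mean g h : (forall x, x \in B -> g x <= h x) ->
  uniform_mean B g <= uniform_mean B h.
Proof.
by move=> gh; apply: ler_wpM2l; [rewrite invr_ge0 ler0n|exact: ler_sum].
Qed.

Lemma uniform_meanDl (c : R) g : (0 < #|B|)%N ->
  uniform_mean B (fun x => c + g x) = c + uniform_mean B g.
Proof.
move=> B_gt0; rewrite /uniform_mean big_split sumr_const mulrDr; congr (_ + _).
by rewrite mulrnAr -mulrnAl -mulr_natr mulVf ?mul1r // pnatr_eq0 -lt0n.
Qed.

End UniformMeans.

(** * Assembling the guarantee *)

Lemma expected_output_value_resampled (R : realType) (N : finType)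
    (F : {set {set N}}) (f : {set N} -> R) (tie : rel N) (d : measure_display)
    (Omega : measurableType d) (P : probability Omega R)
    (A : Omega -> online_rule R N) (p : R) :
  expected_output_value F f tie P A p
  = sample_mean p (fun L C => uniform_mean (arrival_orders N) (fun s =>
      \int[P]_o f (selected (A o) (surrogate_weight F f tie L C) s
                     :&: eligible F f tie L C))).
Proof.
pose value L C (s : seq N) :=
  \int[P]_o f (selected (A o) (surrogate_weight F f tie L C) s
                 :&: eligible F f tie L C).
pose H L s := \sum_(C : {set N}) coin_prob p C * value L C s.
transitivity (\sum_(L : {set N}) coin_prob 2^-1 L *
    uniform_mean (arrival_orders N) (fun s => H L s)).
  rewrite -mean_resample; congr (_ * _); apply: eq_bigr => s _.
  apply: eq_bigr => x _; congr (_ * _).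
  by rewrite uniform_mean_sum.
by apply: eq_bigr => L _; rewrite uniform_mean_sum.
Qed.

(** With [alpha = 3 k p] the claimed factor is [9/128 p^2], and [k p] is at most 1/3. The real [k]
    comes from a positive integer, whence the alternative. *)
Lemma competitive_parameter_bound (R : realType) (k alpha X D v0 opt : R)
    (p := alpha / (3%:R * k)) :
  1 <= k -> (k = 1) \/ (2%:R <= k) -> 0 < alpha <= 1 -> 0 <= X -> 0 <= v0 ->
  2^-1 * opt <= (k + 2%:R) * X + v0 ->
  (1 - p) * (X + v0) - v0 <= (1 + p) * D ->
  alpha ^+ 2 / (128%:R * k ^+ 2) * opt
    <= v0 + alpha * (p * X - k * (p * (p * X))) - p * X + p * D.
Proof.
move=> k1 k12 /andP[alpha_gt0 alpha_le1] X_ge0 v0_ge0 opt_le D_ge.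
have k_gt0 : 0 < k by lra.
have alphaE : alpha = 3%:R * k * p by rewrite /p; field; lra.
have p_gt0 : 0 < p by apply: divr_gt0 => //; lra.
have kp : k * p <= 3%:R^-1 by lra.
have p_le : p <= 3%:R^-1 by nra.
have -> : alpha ^+ 2 / (128%:R * k ^+ 2) = 9%:R / 128%:R * p ^+ 2.
  by rewrite alphaE; field; lra.
have opt_le' : 9%:R / 128%:R * p ^+ 2 * opt
    <= 9%:R / 64%:R * p ^+ 2 * ((k + 2%:R) * X + v0).
  have := ler_wpM2l (sqr_ge0 p) opt_le; lra.
(* Multiplying by [1 + p] makes the lower bound on [(1 + p) * D] applicable. *)
apply: le_trans opt_le' _; rewrite alphaE -(ler_pM2l (_ : 0 < 1 + p));
  last by lra.
have pD : p * ((1 - p) * (X + v0) - v0) <= p * ((1 + p) * D).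
  by apply: ler_wpM2l => //; exact: ltW.
(* Coefficients of [p^2 X]: the terms of first order in [p] cancel between [- p X] and [p D],
   leaving the [- 2]. *)
have coef : 9%:R / 64%:R * (k + 2%:R) * (1 + p)
    <= 3%:R * k * (1 - k * p) * (1 + p) - 2%:R.
  case: k12 => [k_eq|k2]; first by rewrite k_eq in kp *; nra.
  have : 3%:R * k * (3%:R^-1 - k * p) * (1 + p) >= 0.
    by apply: mulr_ge0; [apply: mulr_ge0|]; lra.
  nra.
have coefX : p ^+ 2 * X * (9%:R / 64%:R * (k + 2%:R) * (1 + p))
    <= p ^+ 2 * X * (3%:R * k * (1 - k * p) * (1 + p) - 2%:R).
  by apply: ler_wpM2l coef; apply: mulr_ge0 => //; exact: sqr_ge0.
have coef0 : v0 * (9%:R / 64%:R * p ^+ 2 * (1 + p) + p ^+ 2) <= v0 * (1 + p).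
  apply: ler_wpM2l => //; nra.
lra.
Qed.

Theorem theorem43 (R : realType) (N : finType) (k : nat)
    (I : 'I_k -> {set {set N}}) (f : {set N} -> R) (tie : rel N) (alpha : R)
    (d : measure_display) (Omega : measurableType d)
    (P : probability Omega R) (A : Omega -> online_rule R N)
    (OPT : {set N}) :
  (0 < k)%N ->
  (forall i, matroid (I i)) ->
  (forall S, 0 <= f S) ->
  submodular f ->
  total_order tie ->
  0 < alpha <= 1 ->
  competitive P A (common_independent I) alpha ->
  maximizes f (common_independent I) OPT ->
  alpha ^+ 2 / (128%:R * k%:R ^+ 2) * f OPT <=
    expected_output_value (common_independent I) f tie P A
      (alpha / (3%:R * k%:R)).
Proof.
move=> k_gt0 I_matroid f_ge0 f_submod tie_order alpha01 [A_meas _ A_ratio]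
  [OPT_F _].
have k1 : 1 <= k%:R :> R by rewrite ler1n.
have k12 : k%:R = 1 :> R \/ 2%:R <= k%:R :> R.
  by case: (k) k_gt0 => [|[|k']] // _; [left|right; rewrite ler_nat].
have [alpha_gt0 alpha_le1] := andP alpha01.
set p := alpha / _.
have p01 : 0 <= p <= 1.
  apply/andP; split; first by apply: divr_ge0; lra.
  by rewrite /p ler_pdivrMr; lra.
have X_ge0 := expected_solution_weight_ge0 I f tie.
have X_ge := expected_solution_weight_ge I_matroid f_ge0 f_submod tie_order
  OPT_F.
have D_ge := expected_late_weight_ge I f_ge0 f_submod tie_order p01.
apply: le_trans (competitive_parameter_bound k1 k12 alpha01 X_ge0 (f_ge0 _)
  X_ge D_ge) _.
rewrite expected_output_value_resampled.
apply: sample_mean_secretary_ge => // [|L C]; first exact: ltW.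
set w := surrogate_weight _ f tie L C; set E := eligible _ f tie L C.
have w_ge0 u : 0 <= w u.
  rewrite /w surrogate_weightE //;
    case: ifP => // /(eligible_considered tie_order).
  exact: weight_ge0.
set loss := \sum_(u in E) _.
(* The competitive ratio refers to a set of maximum weight, which exists by finiteness. *)
have [S [SF S_max]] : exists S, maximizes (fun S => \sum_(u in S) w u)
    (common_independent I) S.
  case: (Order.TotalTheory.arg_maxP (fun S : {set N} => \sum_(u in S) w u)
    (common_independent0 I_matroid)) => S SF S_max.
  by exists S.
have free_le : \sum_(u in free I f tie L C) weight (common_independent I) f tie
  L u
    <= \sum_(u in S) w u.
  apply: le_trans (S_max (free I f tie L C) _); last exact: free_feasible.
  rewrite le_eqVlt; apply/orP; left; apply/eqP; apply: eq_bigr => u.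
  by rewrite /w surrogate_weightE // inE => /andP[-> _].
(* Sample and coins, hence [w], are fixed while the input order is still uniform, so the linear
   guarantee applies to [w]. *)
have ratio := A_ratio w w_ge0 S (conj SF S_max).
apply: (@le_trans _ _ (uniform_mean (arrival_orders N) (fun s =>
    f finset.set0 - loss + \int[P]_o \sum_(u in selected (A o) w s) w u))).
  rewrite uniform_meanDl ?arrival_orders_neq0 //.
  have := ler_wpM2l (ltW alpha_gt0) free_le; lra.
apply: ler_uniform_mean => s _.
apply: (integral_selected_ge P A_meas (G := fun Q => f (Q :&: E))) => Q.
have := selected_value_ge I f_submod tie_order L C Q.
by rewrite -/w -/E -/loss; lra.
Qed.
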